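(* Let $f:\mathbb{R}^n\to\mathbb{R}^n$ be $C^\infty$ with $f(0)=0$, such that $A=\frac{\partial f}{\partial x}(0)$ has no eigenvalue on the imaginary axis. Let $\lambda_1,\dots,\lambda_q$ be the distinct eigenvalues of $A$, $\lambda_j$ having algebraic multiplicity $m_j$ and geometric multiplicity one, let $\phi_{\lambda_j}^{k}\in C^2$, $k=1,\dots,m_j$, be the principal (generalized) eigenfunctions of the Koopman generator of $\dot x=f(x)$ associated with $\lambda_j$, and let $\Phi(x)=(\phi_{\lambda_1}^1(x),\dots,\phi_{\lambda_j}^{k_j}(x),\dots,\phi_{\lambda_q}^{m_q}(x))^\top$ be the vector of these functions, with matrix of eigenvalues $\Lambda$ in real Jordan canonical form. Let $H_0(x,p)=p^\top f(x)$ and consider the PDE $$H_0\Big(x,\frac{\partial W(x,t)}{\partial x}\Big)+\frac{\partial W(x,t)}{\partial t}=0 .$$ Let the initial condition $W_0(x)=W(x,0)\in C^2$ of the PDE lie in the span of the principal (generalized) eigenfunctions, i.e. $$W_0(x)=\sum_{j=1}^q\sum_{k_j=1}^{m_j}P_j^{k_j}\phi_{\lambda_j}^{k_j}(x)=P^\top\Phi(x)$$ for some $n$ constants $P=(P_1^1,\dots,P_j^{k_j},\dots,P_q^{m_q})^\top\in\mathbb{R}^n$. Then the solution $W(x,t)$ of the PDE is given by $$W(x,t)=\sum_{j=1}^q P_j^1e^{-\lambda_jt}\phi_{\lambda_j}^1(x)+\sum_{j=1}^q\sum_{k_j=2}^{m_j}P_j^{k_j}\Big(e^{-\lambda_jt}\phi_{\lambda_j}^{k_j}(x)+te^{-\lambda_jt}\phi_{\lambda_j}^{k_j-1}(x)\Big)=P^\top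 e^{-\Lambda t}\Phi(x).$$ Denote $W(x,t)=\bar W(x,P,t)$. Then $$p_i=\frac{\partial\bar W(x,P,t)}{\partial x_i},\qquad X_j^{k_j}=\frac{\partial\bar W(x,P,t)}{\partial P_j^{k_j}},\qquad i=1,\dots,n,\ j=1,\dots,q,\ k_j=1,\dots,m_j,$$ defines a canonical change of coordinates in which the Hamiltonian system $$\dot x=\frac{\partial H_0}{\partial p}=f(x),\qquad \dot p=-\frac{\partial H_0}{\partial x}=-\Big(\frac{\partial f}{\partial x}\Big)^\top p$$ is completely integrable and hence of the form $$\dot X_j^{k_j}=0,\qquad\dot P_j^{k_j}=0,\qquad j=1,\dots,q,\ k_j=1,\dots,m_j.$$
   Context: For $\dot x=f(x)$ with flow $s_t$, the Koopman operators are $[\mathbb{U}_t\psi](x)=\psi(s_t(x))$, and the Koopman generator acts on $C^1$ functions by $\psi\mapsto\frac{\partial\psi}{\partial x}f$. An eigenfunction with eigenvalue $\lambda$ satisfies $\frac{\partial\psi}{\partial x}f=\lambda\psi$, i.e. $\mathbb{U}_t\psi=e^{\lambda t}\psi$. Generalized eigenfunctions $\psi^1,\dots,\psi^m$ with eigenvalue $\lambda$ are taken to satisfy $\mathbb{U}_t\psi^1=e^{\lambda t}\psi^1$ and $\mathbb{U}_t\psi^k=e^{\lambda t}\psi^k+te^{\lambda t}\psi^{k-1}$, expressed in differential form as $\frac{\partial\psi^1}{\partial x}f=\lambda\psi^1$ and $\frac{\partial\psi^k}{\partial x}f=\lambda\psi^k+\psi^{k-1}$, for $k=2,\dots,m$.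 They are called principal when $\lambda$ is an eigenvalue of $A$. (A geometric multiplicity larger than one is treated by listing the eigenspaces separately.) The vector $\Phi$ is written in real form, and $$\frac{\partial\Phi}{\partial x}f=\Lambda\Phi,\qquad[\mathbb{U}_t\Phi](x)=e^{\Lambda t}\Phi(x).$$ All statements are for $x$ in a domain $\mathcal{P}_x\subseteq\mathbb{R}^n$ containing the origin on which the principal (generalized) eigenfunctions are well defined and on which $\Phi$ is a diffeomorphism onto its image that transforms $\dot x=f(x)$ into a linear system.
   Formalization: For k≥2 the summand is corrected to e^{-λt}φ^k + Σ_{i=1}^{k-1} ((-t)^i/i!) e^{-λt}φ^{k-i}, since the printed +te^{-λt}φ^{k-1} fails the PDE when m_j≥2; generalized eigenfunctions are taken in differential form, as the flow form is inconsistent for m_j≥3. *)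

(* Defs.v *)
(* Vectors of R^n are columns, 'cV[R]_n; complex numbers are R[i]. *)
From HB Require Import structures.
From mathcomp Require Export all_boot all_order all_algebra.
From mathcomp Require Export all_classical all_reals all_analysis.
From mathcomp Require Export complex.

Set Implicit Arguments.
Unset Strict Implicit.
Unset Printing Implicit Defensive.

Export Order.TTheory GRing.Theory Num.Theory.
Export numFieldNormedType.Exports.

Global Open Scope classical_set_scope.
Global Open Scope ring_scope.

(* Meant for open D and finite-dimensional V, where continuity of all iterated
   directional derivatives is the usual C^k condition. *)
Fixpoint Ck {R : realType} {V W : normedModType R} (k : nat) (D : set V)
    (g : V -> W) : Prop :=
  match k with
  | 0%N => forall x, D x -> {for x, continuous g}
  | l.+1 => (forall x, D x -> differentiable g x) /\ forall v, Ck l D ('D_v g)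
  end.

Definition smooth {R : realType} {V W : normedModType R} (g : V -> W) : Prop :=
  forall k, Ck k setT g.

Definition diffeo_onto_image {R : realType} {V W : normedModType R} (D : set V)
    (g : V -> W) : Prop :=
  [/\ Ck 1 D g, open (g @` D)
    & exists2 h : W -> V, Ck 1 (g @` D) h & forall x, D x -> h (g x) = x].

Section Calculus.
Context {R : realType} {n : nat}.

Definition grad (g : 'cV[R]_n -> R) (x : 'cV[R]_n) : 'rV[R]_n :=
  \row_i 'D_(delta_mx i 0) g x.

(* Column convention: entry (i, j) is the derivative of g_i along x_j.  The
   library's 'J is stated for row vectors and is the transpose of this. *)
Definition Jac {k : nat} (g : 'cV[R]_n -> 'cV[R]_k) (x : 'cV[R]_n) : 'M[R]_(k, n) :=
  \matrix_(i, j) 'D_(delta_mx j 0) (fun y => g y i 0) x.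

Definition expmx (M : 'M[R]_n) : 'M[R]_n :=
  \matrix_(i, j) limn (series (fun k => (M ^+ k) i j / k`!%:R)).

End Calculus.

Section Complex.
Context {R : realType}.

Definition Cexp (z : R[i]) : R[i] :=
  Complex (expR (complex.Re z) * cos (complex.Im z))
          (expR (complex.Re z) * sin (complex.Im z)).

(* Real form of a family indexed by eigenvalues and stable under conjugation:
   a real eigenvalue keeps its (real) entry z, and a pair lam, lam^* with
   0 < Im lam and entries z, z^* is replaced by Re z (at lam) and
   Im z = - Im (z^* ) (at lam^* ). *)
Definition real_form (lam z : R[i]) : R :=
  if 0 <= complex.Im lam then complex.Re z else - complex.Im z.

Definition complexify {n : nat} (A : 'M[R]_n) : 'M[R[i]]_n :=
  map_mx (real_complex R) A.

(* The library's eigenspaces consist of row (left) eigenvectors; their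
   dimensions are the geometric multiplicities. *)
Definition nonderogatory_spectrum {n q : nat} (A : 'M[R]_n)
    (lam : 'I_q -> R[i]) (m : 'I_q -> nat) : Prop :=
  [/\ injective lam,
      forall z, eigenvalue (complexify A) z <-> exists j, z = lam j,
      forall j, mup (lam j) (char_poly (complexify A)) = m j
    & forall j, \rank (eigenspace (complexify A) (lam j)) = 1%N].

End Complex.

Section Koopman.
Context {R : realType} {n : nat}.
Implicit Types (f : 'cV[R]_n -> 'cV[R]_n) (D : set 'cV[R]_n).
Implicit Types (psi : 'cV[R]_n -> R[i]).

Definition CkC (k : nat) D psi : Prop :=
  Ck k D (fun x => complex.Re (psi x)) /\ Ck k D (fun x => complex.Im (psi x)).

Definition koopman_generator f psi (x : 'cV[R]_n) : R[i] :=
  Complex ((grad (fun y => complex.Re (psi y)) x *m f x) 0 0)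
          ((grad (fun y => complex.Im (psi y)) x *m f x) 0 0).

(* psi 1, ..., psi m; the values of psi at other indices are irrelevant. *)
Definition generalized_eigenfunctions f D (lam : R[i]) (m : nat)
    (psi : nat -> 'cV[R]_n -> R[i]) : Prop :=
  (forall x, D x -> koopman_generator f (psi 1%N) x = lam * psi 1%N x) /\
  (forall k x, (2 <= k <= m)%N -> D x ->
     koopman_generator f (psi k) x = lam * psi k x + psi k.-1 x).

Definition conjugation_stable D {q : nat} (lam : 'I_q -> R[i]) (m : 'I_q -> nat)
    (phi : 'I_q -> nat -> 'cV[R]_n -> R[i]) : Prop :=
  forall j j', lam j' = conjc (lam j) ->
  forall k x, (1 <= k <= m j)%N -> D x -> phi j' k x = conjc (phi j k x).

End Koopman.

Section RealVectorForm.
Context {R : realType} {n q : nat}.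
Variables (lam : 'I_q -> R[i]) (m : 'I_q -> nat).
Variables (jx : 'I_n -> 'I_q) (kx : 'I_n -> nat).

(* Component a of an n-vector carries the double index (jx a, kx a). *)
Definition enumerates : Prop :=
  [/\ forall a, (1 <= kx a <= m (jx a))%N,
      injective (fun a => (jx a, kx a))
    & forall j k, (1 <= k <= m j)%N -> exists a, jx a = j /\ kx a = k].

Definition Phi_vec (phi : 'I_q -> nat -> 'cV[R]_n -> R[i]) (x : 'cV[R]_n) :
    'cV[R]_n :=
  \col_a real_form (lam (jx a)) (phi (jx a) (kx a) x).

(* Rows act on Phi, so the Jordan ones couple index k to index k - 1.  If
   lam = alpha + i beta with beta > 0, then u = Re phi_lam (stored at lam) and
   v = Im phi_lam (stored at lam^* ) evolve by (alpha u - beta v,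
   beta u + alpha v); in both rows the off-diagonal entry is minus the
   imaginary part of the row's own eigenvalue.  Listing conjugate entries next
   to each other, with kx increasing, gives the usual block-diagonal shape. *)
Definition real_jordan : 'M[R]_n :=
  \matrix_(a, b)
    (((jx b == jx a) && (kx b == kx a))%:R * complex.Re (lam (jx a))
     - ((lam (jx b) == conjc (lam (jx a))) && (kx b == kx a))%:R
         * complex.Im (lam (jx a))
     + ((jx b == jx a) && ((kx b).+1 == kx a))%:R).

End RealVectorForm.

Section Hamiltonian.
Context {R : realType} {n : nat}.
Local Notation E := 'cV[R]_n.
Local Notation phase := ('cV[R]_n * 'cV[R]_n)%type.

Definition H0 (f : E -> E) (x p : E) : R := (p^T *m f x) 0 0.

Definition HJ_solution (H : E -> E -> R) (D : set (E * R)) (W : E * R -> R) : Prop :=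
  Ck 1 D W /\
  forall x t, D (x, t) ->
    H x (grad (fun y => W (y, t)) x)^T + derive1 (fun s => W (x, s)) t = 0.

Definition hamiltonian_solution (H : E -> E -> R) (I : set R) (x p : R -> E) : Prop :=
  forall s, I s ->
    is_derive s 1 x (grad (fun p' => H (x s) p') (p s))^T /\
    is_derive s 1 p (- (grad (fun x' => H x' (p s)) (x s))^T).

Definition generated_by (W : E -> E -> R -> R) (t : R) (x p X P : E) : Prop :=
  p = (grad (fun x' => W x' P t) x)^T /\ X = (grad (fun P' => W x P' t) P)^T.

Definition poisson (g h : phase -> R) (z : phase) : R :=
  let dx (u : phase -> R) := grad (fun x => u (x, z.2)) z.1 in
  let dp (u : phase -> R) := grad (fun p => u (z.1, p)) z.2 in
  (dx g *m (dp h)^T - dp g *m (dx h)^T) 0 0.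

(* The new position is (T z).1 and the new momentum is (T z).2. *)
Definition canonical_coordinates (D : set phase) (T : phase -> phase) : Prop :=
  diffeo_onto_image D T /\
  forall (a b : 'I_n) z, D z ->
    [/\ poisson (fun y => (T y).1 a 0) (fun y => (T y).1 b 0) z = 0,
        poisson (fun y => (T y).2 a 0) (fun y => (T y).2 b 0) z = 0
      & poisson (fun y => (T y).1 a 0) (fun y => (T y).2 b 0) z = (a == b)%:R].

(* The components of F t are n first integrals, in involution and with linearly
   independent differentials; the integrals may depend explicitly on time. *)
Definition completely_integrable_by (D : set phase) (H : E -> E -> R)
    (F : R -> phase -> E) : Prop :=
  forall t,
  [/\ Ck 1 D (F t),
      forall a z, D z ->
        is_derive t 1 (fun s => F s z a 0)
          (- poisson (fun y => F t y a 0) (fun y => H y.1 y.2) z),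
      forall a b z, D z ->
        poisson (fun y => F t y a 0) (fun y => F t y b 0) z = 0
    & forall x p, D (x, p) ->
        \rank (row_mx (Jac (fun y => F t (y, p)) x) (Jac (fun r => F t (x, r)) p)) = n].

End Hamiltonian.

(* Main.v *)
From HB Require Import structures.
From mathcomp Require Import ring.
Require Import Defs.

Set Implicit Arguments.
Unset Strict Implicit.
Unset Printing Implicit Defensive.

(** The eigenfunction equations say that Phi conjugates f to the linear field
    Lambda, i.e. J f = Lambda Phi with J the Jacobian of Phi.  Hence
    W(x, t) = P^T e^{-t Lambda} Phi(x) solves the Hamilton-Jacobi equation, and
    a solution is constant along the curves (x(t), t) with x' = f(x), which
    gives uniqueness; the scalar formula holds because both sides solve the same
    linear ODE in t.
    The generating function W yields the map
      X = e^{-t Lambda} Phi(x),   P = (e^{t Lambda})^T J(x)^{-T} p.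
    The brackets {P_a, P_b} vanish because the second derivatives of Phi are
    symmetric; that X and P are constants of motion follows from the equation
    obtained by differentiating J f = Lambda Phi,
      D_f J + J Df = Lambda J. *)

(** * Continuously differentiable maps *)

(** For each [t] the map from (x, p) to (X, P) is the cotangent lift of
    [x |-> e^{-t Lambda} Phi(x)]: positions move by the diffeomorphism, momenta by the inverse
    transpose of its Jacobian. This is why it is canonical. The brackets involving X reduce to
    matrix algebra, and only {P_a, P_b} uses second derivatives. [Phi] is merely C^2, so J is merely
    C^1, and the lift is differentiated no more than once. The generating function depends on time,
    so the P are integrals with explicit time dependence. By the rule for such functions the new
    Hamiltonian is [H0 + dW/dt], which vanishes by the Hamilton-Jacobi equation: hence both X and P
    stay constant. No global flow of f is assumed. Uniqueness and the equivalence with Hamilton's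
    equations are therefore statements about given curves that stay in the domain. The scalar
    formula compares two descriptions of one flow: [e^{-t Lambda}] with the real Jordan matrix, and
    complex Jordan chains where the nilpotent part exponentiates to a finite sum with coefficients
    (-t)^i / i!. Stability under conjugation links them, since each row of the real matrix also
    involves the entry stored at the conjugate eigenvalue. *)

Section NearEq.
Context {R : realType}.
Implicit Types U V W : normedModType R.

Lemma continuous_near_eq (T U : topologicalType) (f g : T -> U) (x : T) :
  {near x, f =1 g} -> {for x, continuous f} -> {for x, continuous g}.
Proof.
move=> fg fc; have e := nbhs_singleton fg.
rewrite /prop_for /continuous_at -e; apply: cvg_trans fc.
by apply: near_eq_cvg.
Qed.

(** The little-o expansion at [x] only sees values near [x], so ['d f x] also serves as an expansion
    of [g]; uniqueness of the differential does the rest. *)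
Lemma diff_near_eq V W (f g : V -> W) (x : V) :
  {near x, f =1 g} -> differentiable f x ->
  differentiable g x /\ 'd g x = 'd f x :> (V -> W).
Proof.
move=> fg df; have e := nbhs_singleton fg.
have H : g \o shift x = cst (g x) + 'd f x +o_ 0 id.
  have [_ /eqaddoP F] := (diff_locallyP x f).1 df.
  apply/eqaddoP => eps eps0; have := F eps eps0.
  have : \forall y \near 0, f (y + x) = g (y + x).
    have : (y + x) @[y --> (0 : V)] --> x.
      by rewrite -[X in _ --> X]add0r; apply: cvgD; [exact: cvg_id|exact: cvg_cst].
    by move/(_ _ fg).
  by apply: filterS2 => y /= fgy; rewrite !fctE /= fgy e.
have dE : 'd g x = 'd f x :> (V -> W).
  by apply: diff_unique H; exact: diff_continuous.
split=> //; apply/diff_locallyP; rewrite dE; split=> //.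
exact: diff_continuous.
Qed.

Lemma open_near_eq V W (D : set V) (f g : V -> W) x :
  open D -> D x -> (forall y, D y -> f y = g y) -> {near x, f =1 g}.
Proof.
by move=> oD Dx fg; apply: filterS (open_nbhs_nbhs (conj oD Dx)) => y /fg.
Qed.

End NearEq.

Section C1.
Context {R : realType}.
Implicit Types U V W : normedModType R.

(** Joint continuity of the differential makes this notion stable under
    composition without any choice of basis; when V consists of columns and D
    is open it is equivalent to [Ck 1] (see [C1_Ck1] and [Ck1_C1]). *)
Definition C1 V W (D : set V) (g : V -> W) := forall x, D x ->
  differentiable g x /\
  forall v, {for (x, v), continuous (fun z : V * V => 'd g (z.1) z.2)}.

Lemma near_fst U V (A : set U) (x : U) (v : V) :
  open A -> A x -> \forall z \near (x, v), A z.1.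
Proof.
move=> oA Ax; apply: (@cvg_fst _ _ (nbhs x) (nbhs v)).
exact: open_nbhs_nbhs.
Qed.

Lemma C1_eq V W (D : set V) (g h : V -> W) :
  open D -> (forall x, D x -> g x = h x) -> C1 D g -> C1 D h.
Proof.
move=> oD gh cg x Dx; have [dg cdg] := cg x Dx.
have near_gh y : D y -> {near y, g =1 h} by move=> Dy; apply: (open_near_eq oD).
split; first by have [] := diff_near_eq (near_gh x Dx) dg.
move=> v; apply: continuous_near_eq (cdg v).
apply: filterS (near_fst v oD Dx) => z /= Dz.
by have [_ ->] := diff_near_eq (near_gh _ Dz) (cg _ Dz).1.
Qed.

Lemma C1_cst V W (D : set V) (c : W) : C1 D (cst c : V -> W).
Proof.
move=> x _; split; first exact: differentiable_cst.
move=> v; rewrite (_ : (fun _ => _) = cst 0); first exact: cst_continuous.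
by apply/funext => z; rewrite diff_cst.
Qed.

Lemma C1_lin V W (D : set V) (f : {linear V -> W}) :
  continuous f -> C1 D f.
Proof.
move=> cf x _; split; first exact: linear_differentiable.
move=> v; rewrite (_ : (fun _ => _) = f \o snd).
  by apply: continuous_comp; [exact: cvg_snd|exact: cf].
by apply/funext => z; rewrite diff_lin.
Qed.

Lemma C1_comp U V W (A : set U) (B : set V) (f : U -> V) (g : V -> W) :
  open A -> (forall x, A x -> B (f x)) -> C1 A f -> C1 B g -> C1 A (g \o f).
Proof.
move=> oA AB cf cg x Ax; have [df cdf] := cf x Ax.
have [dg cdg] := cg _ (AB _ Ax).
split; first exact: differentiable_comp.
move=> v; pose F (z : U * U) := (f z.1, 'd f (z.1) z.2).
apply: (@continuous_near_eq _ _ ((fun z : V * V => 'd g (z.1) z.2) \o F)).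
  apply: filterS (near_fst v oA Ax) => z /= Az.
  by rewrite /= (diff_comp (cf _ Az).1 (cg _ (AB _ Az)).1).
apply: continuous_comp; last exact: cdg.
apply: cvg_pair; last exact: cdf.
apply: (continuous_comp (f := fst) (g := f)); first exact: cvg_fst.
exact: differentiable_continuous.
Qed.

Lemma C1_pair U V W (A : set U) (f : U -> V) (g : U -> W) :
  open A -> C1 A f -> C1 A g -> C1 A (fun x => (f x, g x)).
Proof.
move=> oA cf cg x Ax; have [df cdf] := cf x Ax; have [dg cdg] := cg x Ax.
split; first exact: differentiable_pair.
move=> v; apply: (@continuous_near_eq _ _
   (fun z : U * U => ('d f (z.1) z.2, 'd g (z.1) z.2))).
  apply: filterS (near_fst v oA Ax) => z /= Az.
  by rewrite /= (diff_pair (cf _ Az).1 (cg _ Az).1).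
by apply: cvg_pair; [exact: cdf|exact: cdg].
Qed.

Lemma C1_bilin U V W (A : set (U * V)) (f : {bilinear U -> V -> W}) :
  continuous (fun p => f p.1 p.2) -> C1 A (fun p => f p.1 p.2).
Proof.
move=> fc p _; split; first exact: differentiable_bilin.
move=> v; rewrite (_ : (fun _ => _) =
   (fun z : (U * V) * (U * V) => f z.1.1 z.2.2 + f z.2.1 z.1.2)); last first.
  by apply/funext => z; rewrite diff_bilin.
have c1 : {for (p, v), continuous
    (fun z : (U * V) * (U * V) => (z.1.1, z.2.2))}.
  apply: cvg_pair; apply: (continuous_comp (f := _)) => //=;
    by [exact: cvg_fst|exact: cvg_snd].
have c2 : {for (p, v), continuous
    (fun z : (U * V) * (U * V) => (z.2.1, z.1.2))}.
  apply: cvg_pair; apply: (continuous_comp (f := _)) => //=;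
    by [exact: cvg_fst|exact: cvg_snd].
apply: cvgD.
  exact: (continuous_comp c1 (fc _)).
exact: (continuous_comp c2 (fc _)).
Qed.

Lemma C1D V W (D : set V) (f g : V -> W) :
  open D -> C1 D f -> C1 D g -> C1 D (fun x => f x + g x).
Proof.
move=> oD cf cg x Dx; have [df cdf] := cf x Dx; have [dg cdg] := cg x Dx.
split; first exact: differentiableD.
move=> v; apply: (@continuous_near_eq _ _
   (fun z : V * V => 'd f (z.1) z.2 + 'd g (z.1) z.2)).
  apply: filterS (near_fst v oD Dx) => z /= Dz.
  have := diffD (cf _ Dz).1 (cg _ Dz).1.
  by move=> /(congr1 (fun h : V -> W => h z.2)) /= /esym e; exact: e.
by apply: cvgD; [exact: cdf|exact: cdg].
Qed.

Lemma C1_sum V W (D : set V) (I : Type) (r : seq I) (P : pred I)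
    (f : I -> V -> W) :
  open D -> (forall i, C1 D (f i)) -> C1 D (fun x => \sum_(i <- r | P i) f i x).
Proof.
move=> oD cf; elim: r => [|i r IH].
  by under eq_fun do rewrite big_nil; exact: C1_cst.
under eq_fun do rewrite big_cons.
by case: (P i); [exact: (C1D oD (cf i) IH)|exact: IH].
Qed.

Lemma open_cylinder (V W : normedModType R) (A : set V) :
  open A -> open (A `*` [set: W]).
Proof.
move=> oA; rewrite (_ : _ `*` _ = fst @^-1` A).
  by apply: open_comp => // z _; exact: cvg_fst.
by apply/seteqP; split => z //= [].
Qed.

Lemma C1_fst (V W : normedModType R) (D : set (V * W)) : C1 D (@fst V W).
Proof. by apply: (C1_lin (f := @fst V W)) => z; exact: cvg_fst. Qed.

Lemma C1_snd (V W : normedModType R) (D : set (V * W)) : C1 D (@snd V W).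
Proof. by apply: (C1_lin (f := @snd V W)) => z; exact: cvg_snd. Qed.

End C1.

(** * Matrix-valued C1 maps, and the comparison of [C1] with [Ck] *)

Section C1matrix.
Context {R : realType}.
Implicit Types U V W : normedModType R.

Lemma cvg_sum (T : Type) (F : set_system T) {FF : Filter F} V (I : Type)
    (r : seq I) (P : pred I) (f : I -> T -> V) (a : I -> V) :
  (forall i, P i -> f i x @[x --> F] --> a i) ->
  \sum_(i <- r | P i) f i x @[x --> F] --> \sum_(i <- r | P i) a i.
Proof.
move=> fa; elim: r => [|i r IH].
  under eq_fun do rewrite big_nil; rewrite big_nil; exact: cvg_cst.
under eq_fun do rewrite big_cons; rewrite big_cons.
by case: ifPn => // Pi; apply: cvgD => //; exact: fa.
Qed.

Lemma continuous_mx (T : topologicalType) m n (M : T -> 'M[R]_(m, n)) x :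
  (forall i j, {for x, continuous (fun y => M y i j)}) -> {for x, continuous M}.
Proof.
move=> cM.
have -> : M = (fun y => \sum_i \sum_j M y i j *: delta_mx i j).
  by apply/funext => y; exact: matrix_sum_delta.
apply: cvg_sum => i _; apply: cvg_sum => j _.
by apply: cvgZ; [exact: cM|exact: cvg_cst].
Qed.

Lemma mulmx_continuous m n p :
  continuous (fun q : 'M[R]_(m, n) * 'M[R]_(n, p) => q.1 *m q.2).
Proof.
move=> q; apply: continuous_mx => i j.
rewrite /prop_for /continuous_at mxE; under eq_fun do rewrite mxE.
apply: cvg_sum => k _.
apply: cvgM.
  apply: (continuous_comp (f := fst) (g := fun M : 'M[R]_(m, n) => M i k)).
    exact: cvg_fst.
  exact: coord_continuous.
apply: (continuous_comp (f := snd) (g := fun M : 'M[R]_(n, p) => M k j)).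
  exact: cvg_snd.
exact: coord_continuous.
Qed.

Lemma C1_mulmx V (D : set V) m n p (A : V -> 'M[R]_(m, n))
    (B : V -> 'M[R]_(n, p)) :
  open D -> C1 D A -> C1 D B -> C1 D (fun x => A x *m B x).
Proof.
move=> oD cA cB.
apply: (C1_comp (B := setT) (f := fun x => (A x, B x))
  (g := fun q => q.1 *m q.2)) => //; first exact: C1_pair.
exact: (C1_bilin (f := @mulmx R m n p) (@mulmx_continuous m n p)).
Qed.

Lemma C1M V (D : set V) (f g : V -> R) :
  open D -> C1 D f -> C1 D g -> C1 D (fun x => f x * g x).
Proof.
move=> oD cA cB.
apply: (C1_comp (B := setT) (f := fun x => (f x, g x))
  (g := fun q => q.1 * q.2)) => //; first exact: C1_pair.
by apply: (C1_bilin (f := @GRing.mul R)) => q; exact: mul_continuous.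
Qed.

Lemma C1Zl V W (D : set V) (f : V -> R) (w : W) :
  open D -> C1 D f -> C1 D (fun x => f x *: w).
Proof.
move=> oD cf x Dx; have [df cdf] := cf x Dx; split.
  exact: differentiableZl.
move=> v; apply: (@continuous_near_eq _ _
   (fun z : V * V => 'd f (z.1) z.2 *: w)).
  apply: filterS (near_fst v oD Dx) => z /= Dz.
  by rewrite /= (diffZl w (cf _ Dz).1).
by apply: cvgZ; [exact: cdf|exact: cvg_cst].
Qed.

Lemma C1_mx V (D : set V) m n (A : V -> 'M[R]_(m, n)) :
  open D -> (forall i j, C1 D (fun x => A x i j)) -> C1 D A.
Proof.
move=> oD cA.
have -> : A = (fun y => \sum_i \sum_j A y i j *: delta_mx i j).
  by apply/funext => y; exact: matrix_sum_delta.
by apply: C1_sum => // i; apply: C1_sum => // j; exact: C1Zl.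
Qed.

Lemma C1_coord V (D : set V) m n (A : V -> 'M[R]_(m, n)) i j :
  open D -> C1 D A -> C1 D (fun x => A x i j).
Proof.
move=> oD cA.
have lin : linear (fun M : 'M[R]_(m, n) => M i j : R).
  by move=> a M N; rewrite !mxE.
pose lM := GRing.isLinear.Build _ _ _ _ _ lin.
pose l : {linear 'M[R]_(m, n) -> R} := HB.pack (fun M : 'M[R]_(m, n) => M i j : R) lM.
apply: (C1_comp (B := setT) (g := l)) => //.
by apply: C1_lin; exact: coord_continuous.
Qed.

Lemma C1_trmx V (D : set V) m n (A : V -> 'M[R]_(m, n)) :
  open D -> C1 D A -> C1 D (fun x => (A x)^T).
Proof.
move=> oD cA; apply: C1_mx => // i j; under eq_fun do rewrite mxE.
exact: C1_coord.
Qed.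

Lemma C1_inv V (D : set V) (f : V -> R) :
  open D -> (forall x, D x -> f x != 0) -> C1 D f -> C1 D (fun x => (f x)^-1).
Proof.
move=> oD f0 cf x Dx; have [df cdf] := cf x Dx; split.
  exact: differentiableV (f0 _ Dx).
move=> v; apply: (@continuous_near_eq _ _
   (fun z : V * V => - f z.1 ^- 2 *: 'd f (z.1) z.2)).
  apply: filterS (near_fst v oD Dx) => z /= Dz.
  have := diffV (cf _ Dz).1 (f0 _ Dz).
  by move=> /(congr1 (fun h : V -> R => h z.2)) /= /esym e; exact: e.
apply: cvgZ; last exact: cdf.
apply: cvgN; apply: cvgV; first by rewrite expf_neq0 // f0.
have cfx : {for (x, v), continuous (f \o fst)}.
  apply: continuous_comp; first exact: cvg_fst.
  exact: differentiable_continuous.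
exact: (cvgM cfx cfx).
Qed.

Lemma C1_prod V (D : set V) (I : Type) (r : seq I) (P : pred I)
    (f : I -> V -> R) :
  open D -> (forall i, C1 D (f i)) -> C1 D (fun x => \prod_(i <- r | P i) f i x).
Proof.
move=> oD cf; elim: r => [|i r IH].
  by under eq_fun do rewrite big_nil; exact: C1_cst.
under eq_fun do rewrite big_cons.
by case: (P i); [exact: (C1M oD (cf i) IH)|exact: IH].
Qed.

Lemma C1_det V (D : set V) n (A : V -> 'M[R]_n) :
  open D -> C1 D A -> C1 D (fun x => \det (A x)).
Proof.
move=> oD cA; apply: C1_sum => // s; apply: C1M => //; first exact: C1_cst.
by apply: C1_prod => // i; exact: C1_coord.
Qed.

Lemma C1_invmx V (D : set V) n (A : V -> 'M[R]_n) :
  open D -> (forall x, D x -> A x \in unitmx) -> C1 D A ->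
  C1 D (fun x => invmx (A x)).
Proof.
move=> oD uA cA.
(* On invertible matrices the inverse is the adjugate divided by the determinant, hence rational in
   the entries. *)
apply: (@C1_eq _ _ _ _ (fun x => \matrix_(i, j) ((\det (A x))^-1 *
   ((-1) ^+ (j + i) * \det (row' j (col' i (A x)))))) _ oD).
  by move=> x Dx; apply/matrixP => i j; rewrite /invmx uA // !mxE.
apply: (C1_mx oD) => i j; under eq_fun do rewrite mxE.
apply: (C1M oD).
  apply: (C1_inv oD _ (C1_det oD cA)) => x Dx.
  by rewrite -unitfE -unitmxE uA.
apply: (C1M oD (C1_cst _)).
apply: (C1_det oD); apply: (C1_mx oD) => k l; under eq_fun do rewrite !mxE.
exact: C1_coord oD cA.
Qed.

Lemma C1_Ck1 V W (D : set V) (g : V -> W) : open D -> C1 D g -> Ck 1 D g.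
Proof.
move=> oD cg; split=> [x Dx|v x Dx]; first exact: (cg x Dx).1.
apply: (@continuous_near_eq _ _ (fun y => 'd g y v)).
  by apply: (open_near_eq oD Dx) => y Dy; rewrite deriveE //; exact: (cg _ Dy).1.
apply: (continuous_comp (f := fun y => (y, v)) (g := fun z : V * V => 'd g (z.1) z.2)).
  by apply: cvg_pair; [exact: cvg_id|exact: cvg_cst].
exact: (cg x Dx).2.
Qed.

(** Finite dimension enters here: ['d g x v] is a finite sum of coordinates of [v] times partial
    derivatives at [x], so continuity of each partial derivative in [x] already gives joint
    continuity in (x, v). *)
Lemma Ck1_C1 W n (D : set 'cV[R]_n) (g : 'cV[R]_n -> W) :
  open D -> Ck 1 D g -> C1 D g.
Proof.
move=> oD [dg cg] x Dx; split; first exact: dg.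
move=> v; apply: (@continuous_near_eq _ _ (fun z : 'cV[R]_n * 'cV[R]_n =>
    \sum_i z.2 i 0 *: 'D_(delta_mx i 0) g z.1)).
  apply: filterS (near_fst v oD Dx) => z /= Dz.
  rewrite [in RHS](matrix_sum_delta z.2) linear_sum; apply: eq_bigr => i _.
  by rewrite big_ord1 linearZ deriveE //; exact: dg.
apply: cvg_sum => i _; apply: cvgZ.
  apply: (continuous_comp (f := snd) (g := fun M : 'cV[R]_n => M i 0)).
    exact: cvg_snd.
  exact: coord_continuous.
apply: (continuous_comp (f := fst) (g := 'D_(delta_mx i 0) g)).
  exact: cvg_fst.
exact: cg.
Qed.

Lemma Ck_eq V W k (D : set V) (g h : V -> W) :
  open D -> (forall x, D x -> g x = h x) -> Ck k D g -> Ck k D h.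
Proof.
move=> oD; elim: k g h => [|k IH] g h gh.
  by move=> cg x Dx; apply: continuous_near_eq (cg x Dx); exact: (open_near_eq oD).
move=> [dg cg]; split=> [x Dx|v].
  by have [] := diff_near_eq (open_near_eq oD Dx gh) (dg x Dx).
apply: IH (cg v) => x Dx; apply: near_eq_derive; exact: (open_near_eq oD Dx gh).
Qed.

(** Serves the entries of [Phi_vec] at eigenvalues of negative imaginary part, where [real_form]
    stores minus the imaginary part. *)
Lemma CkN V W k (D : set V) (g : V -> W) :
  open D -> Ck k D g -> Ck k D (fun x => - g x).
Proof.
move=> oD; elim: k g => [|k IH] g.
  by move=> cg x Dx; apply: cvgN; exact: cg.
move=> [dg cg]; split=> [x Dx|v]; first by apply: differentiableN; exact: dg.
apply: Ck_eq (IH _ (cg v)) => // x Dx; rewrite deriveN //.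
exact/diff_derivable/dg.
Qed.

Lemma continuous_mulmxl m k l (A : 'M[R]_(m, k)) :
  continuous (fun B : 'M[R]_(k, l) => A *m B).
Proof.
move=> B; have p : {for B, continuous (fun B : 'M[R]_(k, l) => (A, B))}.
  have c : {for B, continuous (fun B : 'M[R]_(k, l) => B)} by exact: cvg_id.
  exact: (cvg_pair (cvg_cst A) c).
exact: (continuous_comp p (@mulmx_continuous m k l _)).
Qed.

End C1matrix.

(** * Derivatives along curves and symmetry of second derivatives *)

Section Curves.
Context {R : realType}.
Implicit Types U V W : normedModType R.

Lemma is_derive_comp V W (c : R -> V) (g : V -> W) (t : R) (c' : V) :
  is_derive t 1 c c' -> differentiable g (c t) ->
  is_derive t 1 (g \o c) ('d g (c t) c').
Proof.
move=> [/derivable1_diffP dc cE] dg.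
have dgc : differentiable (g \o c) t by exact: differentiable_comp.
split; first exact/derivable1_diffP.
by rewrite deriveE // (diff_comp dc dg) /= -cE deriveE.
Qed.

Lemma is_derive_mxP V m n (M : V -> 'M[R]_(m, n)) t v M' :
  is_derive t v M M' <-> forall i j, is_derive t v (fun x => M x i j) (M' i j).
Proof.
split=> [[dM ME] i j|dM].
  split; first exact: (derivable_mxP M t v).1.
  by rewrite -ME derive_mx // mxE.
have drM : derivable M t v.
  by apply/derivable_mxP => i j; apply: ex_derive; exact: dM.
split=> //; rewrite derive_mx //; apply/matrixP => i j; rewrite mxE.
by apply: derive_val; exact: dM.
Qed.

Lemma is_derive_bigsum V W n (h : 'I_n -> V -> W) x v (dh : 'I_n -> W) :
  (forall i, is_derive x v (h i) (dh i)) ->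
  is_derive x v (fun y => \sum_(i < n) h i y) (\sum_(i < n) dh i).
Proof.
move=> H; have := is_derive_sum H.
by rewrite (_ : \sum_(i < n) h i = fun y => \sum_(i < n) h i y) // funeqE => y;
  rewrite fct_sumE.
Qed.

Lemma is_derive_mulmx V m n p (A : V -> 'M[R]_(m, n)) (B : V -> 'M[R]_(n, p))
    x v A' B' :
  is_derive x v A A' -> is_derive x v B B' ->
  is_derive x v (fun y => A y *m B y) (A' *m B x + A x *m B').
Proof.
move=> /is_derive_mxP dA /is_derive_mxP dB; apply/is_derive_mxP => i j.
under eq_fun do rewrite mxE.
rewrite !mxE -big_split /=; apply: is_derive_bigsum => k.
apply: (@is_derive_eq _ _ _ _ _ _ _ _ (is_deriveM (dA i k) (dB k j))).
by rewrite addrC [_ *: A' i k]mulrC.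
Qed.

Lemma is_derive_trmx V m n (A : V -> 'M[R]_(m, n)) x v A' :
  is_derive x v A A' -> is_derive x v (fun y => (A y)^T) A'^T.
Proof.
move=> /is_derive_mxP dA; apply/is_derive_mxP => i j.
by under eq_fun do rewrite mxE; rewrite mxE; exact: dA.
Qed.

Lemma is_derive_diff V W (g : V -> W) x v :
  differentiable g x -> is_derive x v g ('d g x v).
Proof. by move=> dg; split; [exact: diff_derivable|rewrite deriveE]. Qed.

Lemma MVT_closed (g dg : R -> R) (a b : R) : a <= b ->
  (forall s, a <= s <= b -> is_derive s 1 g (dg s)) ->
  exists2 c, a <= c <= b & g b - g a = dg c * (b - a).
Proof.
move=> ab Hg.
have [||c] := @MVT_segment _ g dg _ _ ab.
- by move=> x; rewrite in_itv /= => /andP[ax xb]; apply: Hg; rewrite !ltW.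
- apply: derivable_within_continuous => x; rewrite in_itv /= => xab.
  by apply: ex_derive; exact: Hg.
by rewrite in_itv /= => cab e; exists c.
Qed.

Lemma is_derive0_const (g : R -> R) (t : R) :
  (forall s, Num.min 0 t <= s <= Num.max 0 t -> is_derive s 1 g 0) ->
  g t = g 0.
Proof.
have [t0|t0] := leP 0 t => Hg.
  have [c _] := MVT_closed t0 Hg.
  by rewrite mul0r => /eqP; rewrite subr_eq0 => /eqP.
have [c _] := MVT_closed (ltW t0) Hg.
by rewrite mul0r => /eqP; rewrite subr_eq0 => /eqP.
Qed.

Lemma is_derive_line V W (g : V -> W) (a u : V) (s : R) :
  differentiable g (a + s *: u) ->
  is_derive s 1 (fun r => g (a + r *: u)) ('D_u g (a + s *: u)).
Proof.
move=> dg; rewrite deriveE //.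
have := @is_derive_comp V W (fun r => a + r *: u) g s u _ dg; apply.
have scal : is_derive s 1 (fun r : R => r *: u) u.
  have d : is_diff s (fun r : R => r *: u) (fun r : R => r *: u).
    exact: is_diff_scalel.
  have := is_derive_diff (1 : R) (@ex_diff _ _ _ _ _ _ _ d).
  by rewrite diff_val scale1r.
have := is_deriveD (is_derive_cst a s (1 : R)) scal; rewrite add0r; exact.
Qed.

Lemma second_difference V (D : set V) (g : V -> R) (x u v : V) (h : R) :
  0 <= h -> Ck 2 D g ->
  (forall s r : R, 0 <= s <= h -> 0 <= r <= h -> D (x + s *: u + r *: v)) ->
  exists s r : R, [/\ 0 <= s <= h, 0 <= r <= h &
    g (x + h *: u + h *: v) - g (x + h *: u) - (g (x + h *: v) - g x)
    = 'D_v ('D_u g) (x + s *: u + r *: v) * h * h].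
Proof.
move=> h0 [dg dDg] Dh.
have hh : 0 <= h <= h by rewrite h0 lexx.
have Dh0 s : 0 <= s <= h -> D (x + s *: u).
  by move=> sh; have := Dh s 0 sh; rewrite scale0r addr0 lexx h0; apply.
have swap s : x + s *: u + h *: v = x + h *: v + s *: u by rewrite addrAC.
(* The first mean value theorem moves along [u] and is applied to the increment in direction [v];
   what remains is an increment of ['D_u g] along [v], ready for the second one. *)
have [|s sh e] := @MVT_closed
  (fun s => g (x + h *: v + s *: u) - g (x + s *: u))
  (fun s => 'D_u g (x + h *: v + s *: u) - 'D_u g (x + s *: u)) _ _ h0.
  move=> s sh; apply: is_deriveB; apply: is_derive_line; apply: dg.
    by rewrite -swap; exact: Dh.
  exact: Dh0.
have [|r rh e'] := @MVT_closed
  (fun r => 'D_u g (x + s *: u + r *: v))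
  (fun r => 'D_v ('D_u g) (x + s *: u + r *: v)) _ _ h0.
  by move=> r rh; apply: is_derive_line; apply: (dDg u).1; exact: Dh.
exists s, r; split=> //.
move: e e'; rewrite !scale0r !addr0 !subr0 -!swap => e e'.
by rewrite e -e'.
Qed.

Lemma small_parallelogram V (A : set V) (x u v : V) : nbhs x A ->
  exists2 h : R, 0 < h &
    forall s r : R, 0 <= s <= h -> 0 <= r <= h -> A (x + s *: u + r *: v).
Proof.
move=> Ax.
have c : (x + z.1 *: u + z.2 *: v) @[z --> ((0, 0) : R * R)] --> x.
  rewrite -[X in _ --> X]addr0 -[X in _ --> X + _]addr0.
  rewrite -[X in _ --> _ + X + _](scale0r u) -[X in _ --> _ + X](scale0r v).
  apply: cvgD; first apply: cvgD; first exact: cvg_cst.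
  - by apply: cvgZ; [exact: cvg_fst|exact: cvg_cst].
  - by apply: cvgZ; [exact: cvg_snd|exact: cvg_cst].
have /nbhs_ballP[e /= e0 H] := c _ Ax.
exists (e / 2); first by rewrite divr_gt0.
have small s : 0 <= s <= e / 2 -> ball (0 : R) e s.
  move=> /andP[s0 se]; rewrite -ball_normE /= sub0r normrN ger0_norm //.
  by rewrite (le_lt_trans se) // ltr_pdivrMr // ltr_pMr // ltr1n.
by move=> s r /small sB /small rB; apply: (H (s, r)).
Qed.

Lemma dist_le_of_common (a b c d e : R) :
  c = d -> `|a - c| < e / 2 -> `|b - d| < e / 2 -> `|a - b| <= e.
Proof.
move=> <- ac bc; rewrite (le_trans (ler_distD c a b)) // (splitr e) lerD ?ltW //.
by rewrite distrC.
Qed.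

(** By the mean value theorem applied twice, both mixed derivatives, taken at
    suitable points near x, equal the same second difference divided by h ^ 2. *)
Lemma schwarz V (D : set V) (g : V -> R) (x u v : V) :
  open D -> Ck 2 D g -> D x -> 'D_v ('D_u g) x = 'D_u ('D_v g) x.
Proof.
move=> oD cg Dx; apply/eqP; rewrite -subr_eq0 -normr_le0; apply/ler_addgt0Pr => e e0.
rewrite add0r.
have c1 := (cg.2 u).2 v x Dx; have c2 := (cg.2 v).2 u x Dx.
have e2 : 0 < e / 2 by rewrite divr_gt0.
move/cvgrPdist_lt: c1 => /(_ _ e2) n1; move/cvgrPdist_lt: c2 => /(_ _ e2) n2.
have [h h0 H] := small_parallelogram u v
  (filterI (open_nbhs_nbhs (conj oD Dx)) (filterI n1 n2)).
have [|s [r [sh rh E1]]] := @second_difference V D g x u v h (ltW h0) cg.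
  by move=> s r sh rh; have [] := H s r sh rh.
have [|s' [r' [sh' rh' E2]]] := @second_difference V D g x v u h (ltW h0) cg.
  by move=> s' r' sh' rh'; rewrite addrAC; have [] := H r' s' rh' sh'.
(* The second difference is symmetric in [u] and [v], so the two expressions [E1] and [E2] agree;
   the two factors [h] are then cancelled. *)
have E : 'D_v ('D_u g) (x + s *: u + r *: v) = 'D_u ('D_v g) (x + r' *: u + s' *: v).
  apply: (mulIf (lt0r_neq0 h0)); apply: (mulIf (lt0r_neq0 h0)).
  rewrite (addrAC x (r' *: u)); apply: etrans (esym E1) _; apply: etrans _ E2.
  rewrite (addrAC x (h *: v)); move: (g _) (g _) (g _) (g _) => a b c d.
  by rewrite !opprD !opprK !addrA [X in X + _ = _]addrAC.
exact: dist_le_of_common E (H _ _ sh rh).2.1 (H _ _ rh' sh').2.2.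
Qed.

Lemma diff_idE (V : normedModType R) (x v : V) : 'd (fun y : V => y) x v = v.
Proof. by rewrite -deriveE // derive_id. Qed.

Lemma diff_partial1 (U V W : normedModType R) (g : U * V -> W) x y :
  differentiable g (x, y) -> differentiable (fun x' => g (x', y)) x /\
  forall v, 'd (fun x' => g (x', y)) x v = 'd g (x, y) (v, 0).
Proof.
move=> dg.
have did : differentiable (fun x' : U => x') x by [].
have dc : differentiable (fun _ : U => y) x by exact: differentiable_cst.
have dp := differentiable_pair did dc.
split; first exact: (differentiable_comp dp dg).
move=> v; have := diff_comp dp dg => /(congr1 (fun h : U -> W => h v)) /= ->.
by rewrite (diff_pair did dc) diff_idE diff_cst.
Qed.

Lemma diff_partial2 (U V W : normedModType R) (g : U * V -> W) x y :
  differentiable g (x, y) -> differentiable (fun y' => g (x, y')) y /\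
  forall v, 'd (fun y' => g (x, y')) y v = 'd g (x, y) (0, v).
Proof.
move=> dg.
have did : differentiable (fun y' : V => y') y by [].
have dc : differentiable (fun _ : V => x) y by exact: differentiable_cst.
have dp := differentiable_pair dc did.
split; first exact: (differentiable_comp dp dg).
move=> v; have := diff_comp dp dg => /(congr1 (fun h : V -> W => h v)) /= ->.
by rewrite (diff_pair dc did) diff_idE diff_cst.
Qed.

End Curves.

(** * The matrix exponential *)

Section Expmx.
Context {R : realType} {n : nat}.
Implicit Types (L M : 'M[R]_n) (t : R).

Lemma expr_scalemx t L k : (t *: L) ^+ k = t ^+ k *: L ^+ k.
Proof.
elim: k => [|k IH]; first by rewrite !expr0 scale1r.
by rewrite !exprS IH -[LHS]scalemxAl -[in LHS]scalemxAr scalerA.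
Qed.

(** The base bounds every row sum of absolute values of [L], so each further factor [L] costs at
    most one factor of it. This dominates the entries of the exponential series by a scalar
    exponential series. *)
Lemma normr_exprmx_le L k i j :
  `|(L ^+ k) i j| <= (1 + \sum_a \sum_b `|L a b|) ^+ k.
Proof.
set B := 1 + _.
have S0 a : 0 <= \sum_b `|L a b| by apply: sumr_ge0.
have B0 : 0 <= B by rewrite addr_ge0 // sumr_ge0.
elim: k i j => [|k IH] i j.
  by rewrite !expr0 mxE; case: eqP => _; rewrite ?normr1 ?normr0.
rewrite !exprS mxE (le_trans (ler_norm_sum _ _ _)) //.
apply: (@le_trans _ _ (\sum_b `|L i b| * B ^+ k)).
  by apply: ler_sum => b _; rewrite normrM ler_wpM2l.
rewrite -mulr_suml ler_wpM2r ?exprn_ge0 //.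
apply: (@le_trans _ _ (\sum_a \sum_b `|L a b|)); last by rewrite /B lerDr.
by rewrite [leRHS](bigD1 i) //= lerDl sumr_ge0.
Qed.

(** The shift [d] is there for termwise differentiation, which asks for convergence of the series
    and of its first two formal derivatives: each formal derivative raises the exponent of [L] by
    one and leaves the factorial unchanged, so these are the cases d = 0, 1, 2. *)
Lemma is_cvg_pseries_exprmx L d i j t :
  cvgn (pseries (fun k => (L ^+ (k + d)) i j / k`!%:R) t).
Proof.
set B := 1 + \sum_a \sum_b `|L a b|.
have B0 : 0 <= B by rewrite addr_ge0 // sumr_ge0 // => a _; exact: sumr_ge0.
apply: normed_cvg; apply: (@series_le_cvg _ _ (B ^+ d *: exp_coeff (B * `|t|))).
- by move=> k; exact: normr_ge0.
- move=> k; apply: mulr_ge0; first exact: exprn_ge0.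
  by rewrite /exp_coeff /= divr_ge0 // exprn_ge0 // mulr_ge0.
- move=> k; have -> : (B ^+ d *: exp_coeff (B * `|t|)) k =
      B ^+ (k + d) / k`!%:R * `|t| ^+ k.
    rewrite -[LHS]/(B ^+ d * ((B * `|t|) ^+ k / k`!%:R)) exprMn exprD.
    by rewrite !mulrA mulrAC [B ^+ d * _]mulrC.
  rewrite /= !normrM normfV normr_nat normrX.
  by rewrite !ler_wpM2r ?invr_ge0 ?exprn_ge0 // normr_exprmx_le.
apply: is_cvg_seriesZ; exact: is_cvg_series_exp_coeff.
Qed.

Lemma expmx_pseriesE L t i j :
  expmx (t *: L) i j = limn (pseries (fun k => (L ^+ k) i j / k`!%:R) t).
Proof.
rewrite mxE; congr (limn (series _)); apply/funext => k.
by rewrite expr_scalemx mxE -mulrA mulrC.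
Qed.

Lemma pseries_diffs_exprmx L d i j :
  pseries_diffs (fun k => (L ^+ (k + d)) i j / k`!%:R) =
  (fun k => (L ^+ (k + d.+1)) i j / k`!%:R).
Proof.
apply/funext => k; rewrite /pseries_diffs factS natrM invfM mulrCA mulVKf //.
by rewrite addSnnS.
Qed.

Lemma cvg_expmx M i j :
  series (fun k => (M ^+ k) i j / k`!%:R) @ \oo --> expmx M i j.
Proof.
have := @is_cvg_pseries_exprmx M 0 i j 1.
rewrite /pseries mxE; under [X in series X]eq_fun do rewrite expr1n mulr1 addn0.
exact.
Qed.

Lemma cvg_mul_expmx M (A : 'M[R]_n) i j :
  series (fun k => (A *m M ^+ k) i j / k`!%:R) @ \oo --> (A *m expmx M) i j.
Proof.
rewrite mxE.
have -> : series (fun k => (A *m M ^+ k) i j / k`!%:R) =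
   (fun N => \sum_l A i l * series (fun k => (M ^+ k) l j / k`!%:R) N).
  apply/funext => N; rewrite /series /=.
  under [RHS]eq_bigr do rewrite mulr_sumr.
  rewrite exchange_big /=; apply: eq_bigr => k _; rewrite mxE mulr_suml.
  by apply: eq_bigr => l _; rewrite mulrA.
by apply: cvg_sum => l _; apply: cvgM; [exact: cvg_cst|exact: cvg_expmx].
Qed.

Lemma cvg_expmx_mul M (A : 'M[R]_n) i j :
  series (fun k => (M ^+ k *m A) i j / k`!%:R) @ \oo --> (expmx M *m A) i j.
Proof.
rewrite mxE.
have -> : series (fun k => (M ^+ k *m A) i j / k`!%:R) =
   (fun N => \sum_l series (fun k => (M ^+ k) i l / k`!%:R) N * A l j).
  apply/funext => N; rewrite /series /=.
  under [RHS]eq_bigr do rewrite mulr_suml.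
  rewrite exchange_big /=; apply: eq_bigr => k _; rewrite mxE mulr_suml.
  by apply: eq_bigr => l _; rewrite mulrAC.
by apply: cvg_sum => l _; apply: cvgM; [exact: cvg_expmx|exact: cvg_cst].
Qed.

(** Both sides are limits, entry by entry, of the same series, since [A] commutes with each power of
    [M]. *)
Lemma expmx_comm M (A : 'M[R]_n) :
  A *m M = M *m A -> A *m expmx M = expmx M *m A.
Proof.
move=> AM; apply/matrixP => i j.
have AMk k : A *m M ^+ k = M ^+ k *m A.
  elim: k => [|k IH]; first by rewrite expr0 [LHS]mulmx1 [RHS]mul1mx.
  by rewrite exprS mulmxA AM -mulmxA IH mulmxA.
apply: cvg_unique (@cvg_mul_expmx M A i j) _ => //.
by under [X in series X]eq_fun do rewrite AMk; exact: cvg_expmx_mul.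
Qed.

Lemma is_derive_expmx L t :
  is_derive t 1 (fun s => expmx (s *: L)) (L *m expmx (t *: L)).
Proof.
apply/is_derive_mxP => i j.
under eq_fun do rewrite expmx_pseriesE.
have <- : limn (pseries (pseries_diffs (fun k => (L ^+ k) i j / k`!%:R)) t) =
   (L *m expmx (t *: L)) i j.
  apply/cvg_lim => //; rewrite /pseries.
  have -> : (fun k => pseries_diffs (fun k => (L ^+ k) i j / k`!%:R) k * t ^+ k)
     = (fun k => (L *m (t *: L) ^+ k) i j / k`!%:R).
    apply/funext => k; rewrite expr_scalemx -scalemxAr mxE.
    have := pseries_diffs_exprmx L 0 i j.
    under eq_fun do rewrite addn0; move=> ->.
    by rewrite addn1 exprS mulrC mulrA.
  exact: cvg_mul_expmx.
have H d := @is_cvg_pseries_exprmx L d i j (`|t| + 1).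
have e0 : (fun k => (L ^+ k) i j / k`!%:R) = (fun k => (L ^+ (k + 0)) i j / k`!%:R).
  by apply/funext => k; rewrite addn0.
(* Any radius beyond [|t|] is suitable, as the series converges everywhere; [|t| + 1] is chosen. *)
rewrite e0; apply: (@pseries_snd_diffs _ _ (`|t| + 1)).
- exact: H.
- rewrite pseries_diffs_exprmx; exact: H.
- rewrite !pseries_diffs_exprmx; exact: H.
by rewrite [ltRHS]ger0_norm ?ltrDl // addr_ge0.
Qed.

Lemma expmx0 L : expmx (0 *: L) = 1%:M.
Proof.
rewrite scale0r; apply/matrixP => i j; apply: cvg_unique (@cvg_expmx 0 i j) _ => //.
apply: (@cvg_near_cst _ _ _ _ _ _).
exists 1%N => // -[//|N] _; rewrite /series /=.
rewrite big_nat_recl // expr0 divr1 big_nat big1 ?addr0 // => k _.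
by rewrite exprS [0 * _]mul0mx mxE mul0r.
Qed.

Lemma is_derive_expmxN L t :
  is_derive t 1 (fun s => expmx (- s *: L)) (- (L *m expmx (- t *: L))).
Proof.
have dE := is_derive_expmx L (- t).
have dopp : is_derive t (1 : R) (-%R : R -> R) (-1) by exact: is_deriveNid.
have [_ dE'] := dE.
have df : differentiable (fun r : R => expmx (r *: L)) (- t).
  by apply/derivable1_diffP; exact: ex_derive.
have := is_derive_comp dopp df.
by rewrite linearN /= -deriveE // dE'.
Qed.

(** The product has zero derivative in [t], because [L] commutes with the exponential, and equals 1
    at [t = 0]. This replaces a product of two series. *)
Lemma expmxK L t : expmx (- t *: L) *m expmx (t *: L) = 1%:M.
Proof.
have cst i j s : ((expmx (- s *: L) *m expmx (s *: L)) i j) =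
    ((expmx (- 0 *: L) *m expmx (0 *: L)) i j).
  apply: (@is_derive_0_is_cst R (fun s => (expmx (- s *: L) *m expmx (s *: L)) i j)).
  move=> r; have := is_derive_mulmx (is_derive_expmxN L r) (is_derive_expmx L r).
  rewrite mulNmx (expmx_comm (A := L)) ?mulmxA ?addNr.
    by move/is_derive_mxP => /(_ i j); rewrite mxE.
  by rewrite -scalemxAl -scalemxAr.
by apply/matrixP => i j; rewrite cst oppr0 expmx0 mulmx1.
Qed.

Lemma C1_expmx L : C1 setT (fun t : R => expmx (t *: L)).
Proof.
have df t : differentiable (fun r : R => expmx (r *: L)) t.
  by apply/derivable1_diffP; apply: ex_derive; exact: is_derive_expmx.
move=> t _; split=> // v.
have -> : (fun z : R * R => 'd (fun r : R => expmx (r *: L)) (z.1) z.2) =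
    (fun z => z.2 *: (L *m expmx (z.1 *: L))).
  apply/funext => z; rewrite -[in LHS](mulr1 z.2) -[_ * _]/(z.2 *: (1 : R)).
  rewrite linearZ -deriveE //; congr (_ *: _).
  by have [_ ->] := is_derive_expmx L z.1.
have c2 : {for (t, v), continuous (fun z : R * R => z.2)} by exact: cvg_snd.
have c : {for (t, v), continuous (fun z : R * R => expmx (z.1 *: L))}.
  have c1 : {for (t, v), continuous (@fst R R)} by exact: cvg_fst.
  exact: (continuous_comp c1 (differentiable_continuous (df t))).
have p : {for (t, v), continuous (fun z : R * R => (L, expmx (z.1 *: L)))}.
  exact: (cvg_pair (cvg_cst L) c).
exact: (cvgZ c2 (continuous_comp p (@mulmx_continuous R n n n _))).
Qed.

Lemma scale_expmx_comm L t : L *m expmx (t *: L) = expmx (t *: L) *m L.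
Proof. by apply: expmx_comm; rewrite -scalemxAl -scalemxAr. Qed.

Lemma expmxNK L t : expmx (t *: L) *m expmx (- t *: L) = 1%:M.
Proof. by have := expmxK L (- t); rewrite opprK. Qed.

End Expmx.

(** * The real Jordan form *)

Section ConjugateSpectrum.
Context {R : realType} {n q : nat}.
Variables (A : 'M[R]_n) (lam : 'I_q -> R[i]) (m : 'I_q -> nat).
Hypothesis spectrum : nonderogatory_spectrum A lam m.

Lemma char_poly_complexify_conj :
  map_poly conjc (char_poly (complexify A)) = char_poly (complexify A).
Proof.
rewrite -map_char_poly -map_poly_comp; apply: eq_map_poly => x /=.
exact: conjc_real.
Qed.

Lemma mup_conjc (p : {poly R[i]}) x : p != 0 -> map_poly conjc p = p ->
  mup (conjc x) p = mup x p.
Proof.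
move=> p0 pE; have le y : (mup y p <= mup (conjc y) p)%N.
  apply: etrans (mup_geq (conjc y) (mup y p) p0) _.
  have XE : map_poly conjc (('X - y%:P) ^+ mup y p) = ('X - (conjc y)%:P) ^+ mup y p.
    by rewrite rmorphXn rmorphB /= map_polyX map_polyC.
  have := dvdp_map (@conjc R) (('X - y%:P) ^+ mup y p) p.
  rewrite XE pE => ->; exact: (etrans (esym (mup_geq y (mup y p) p0)) (leqnn _)).
apply: anti_leq; apply/andP; split; last exact: le.
by have := le (conjc x); rewrite conjcK.
Qed.

(** Provides the partner chain, of equal length, without which the entry coupled to [phi j k] in the
    real Jordan form would have no place in the vector. *)
Lemma spectrum_conj j : exists j', lam j' = conjc (lam j) /\ m j' = m j.
Proof.
have [_ ev mu _] := spectrum.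
have : eigenvalue (complexify A) (conjc (lam j)).
  rewrite eigenvalue_root_char -complex_root_conj char_poly_complexify_conj.
  by rewrite -eigenvalue_root_char; apply/ev; exists j.
move=> /ev[j' e]; exists j'; split=> //; rewrite -!mu -e.
apply: mup_conjc; last exact: char_poly_complexify_conj.
by rewrite monic_neq0 // char_poly_monic.
Qed.

Lemma spectrum_mup_gt0 j : (0 < m j)%N.
Proof.
have [_ ev mu _] := spectrum.
rewrite -mu mup_geq ?monic_neq0 ?char_poly_monic // expr1 dvdp_XsubCl.
by rewrite -eigenvalue_root_char; apply/ev; exists j.
Qed.

End ConjugateSpectrum.

(** * Action of the real Jordan matrix on conjugation-stable families *)

Section RealJordan.
Context {R : realType} {n q : nat}.
Variables (lam : 'I_q -> R[i]) (m : 'I_q -> nat).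
Variables (jx : 'I_n -> 'I_q) (kx : 'I_n -> nat).
Hypothesis lam_inj : injective lam.
Hypothesis lam_conj : forall j, exists j', lam j' = conjc (lam j) /\ m j' = m j.
Hypothesis jkx : enumerates m jx kx.

(** Injectivity of the double index makes the boolean factor a Kronecker delta. *)
Lemma sum_index (W : nmodType) (g : 'I_n -> W) a :
  \sum_b g b *+ ((jx b == jx a) && (kx b == kx a)) = g a.
Proof.
have [_ inj _] := jkx.
rewrite (bigD1 a) //= !eqxx mulr1n big1 ?addr0 // => b ba.
case: andP => // -[/eqP ej /eqP ek]; move: ba; rewrite (inj b a) ?eqxx //.
by rewrite ej ek.
Qed.

Definition real_col (z : 'I_q -> nat -> R[i]) : 'cV[R]_n :=
  \col_a real_form (lam (jx a)) (z (jx a) (kx a)).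

Definition conj_family (z : 'I_q -> nat -> R[i]) := forall j j' k,
  lam j' = conjc (lam j) -> (1 <= k <= m j)%N -> z j' k = conjc (z j k).

Lemma real_form0 l : real_form l 0 = 0 :> R.
Proof. by rewrite /real_form /= oppr0 if_same. Qed.

Lemma real_formD l (w z : R[i]) : real_form l (w + z) = real_form l w + real_form l z.
Proof.
by case: w z => [a b] [c d]; rewrite /real_form /=; case: ifP; rewrite ?opprD.
Qed.

Lemma real_formN l (w : R[i]) : real_form l (- w) = - real_form l w.
Proof. by case: w => [a b]; rewrite /real_form /=; case: ifP. Qed.

(** Multiplication by [l] acts on the pair (Re w, Im w) as a scaled rotation. One component is
    stored at [l], the other at the conjugate of [l], and the sign convention of [real_form] gives
    both rows the same shape. For real [l] the coefficient of the partner entry is zero. *)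
Lemma real_form_rotation (l w : R[i]) :
  real_form l (l * w) = complex.Re l * real_form l w
    - complex.Im l * real_form (conjc l) (conjc w).
Proof.
case: l w => [a b] [u v]; rewrite /real_form /=.
have [b0|b0|b0] := ltrgtP b 0.
- by rewrite oppr_ge0 ltW //=; ring.
- by rewrite oppr_ge0 leNgt b0 /= opprK.
- by rewrite b0 oppr0 lexx /= !mul0r.
Qed.

(** The three summands of a matrix entry select three components: the row's own one, that of the
    conjugate eigenvalue, and the predecessor in the chain. The first two combine by
    [real_form_rotation] into multiplication by [lam j]. *)
Lemma real_jordan_mul (z : 'I_q -> nat -> R[i]) : conj_family z ->
  real_jordan lam jx kx *m real_col z =
  real_col (fun j k => lam j * z j k + (if k == 1%N then 0 else z j k.-1)).
Proof.
move=> zc; have [rng inj sur] := jkx.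
apply/matrixP => a i0; rewrite !mxE.
under eq_bigr do rewrite !mxE !mulrDl mulNr -!mulrA.
rewrite !big_split /= sumrN.
under eq_bigr do rewrite mulr_natl.
rewrite sum_index real_formD real_form_rotation.
congr (_ - _ + _).
(* The partner component [b] exists because the conjugate chain is equally long; injectivity of
   [lam] turns the test on eigenvalues into a test on indices. *)
- have [j' [e em]] := lam_conj (jx a).
  have [|b [jb kb]] := sur j' (kx a); first by rewrite em rng.
  rewrite -(zc (jx a) j') ?rng // -e -jb -kb.
  under eq_bigr do rewrite (inj_eq lam_inj) mulr_natl.
  by rewrite sum_index.
- case: eqP => [k1|k1].
    (* Chain indices start at 1, so no component can be the predecessor of index 1. *)
    rewrite real_form0 big1 // => b _; rewrite k1.
    have /andP[k0 _] := rng b; case: (kx b) k0 => // k _.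
    by rewrite andbF mul0r.
  have /andP[k0 km] := rng a.
  have kp : (1 < kx a)%N by case: (kx a) k1 k0 => [|[]].
  have [|b [jb kb]] := sur (jx a) (kx a).-1.
    by case: (kx a) kp km => [|[|k]] // _ /ltnW.
  rewrite -[in X in _ = X]jb -kb -jb -[in X in X = _](prednK k0) -kb.
  under eq_bigr do rewrite eqSS mulr_natl.
  by rewrite sum_index.
Qed.

End RealJordan.

(** * Complex-valued functions of a real variable *)

Section ComplexDerivative.
Context {R : realType}.
Implicit Types (F G : R -> R[i]) (c d : R[i]) (t : R).

(** Taken by components because [real_form] reads off a single real or imaginary part. *)
Definition is_cderive t F d :=
  is_derive t 1 (fun s => complex.Re (F s)) (complex.Re d) /\
  is_derive t 1 (fun s => complex.Im (F s)) (complex.Im d).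

Lemma is_cderive_cst t c : is_cderive t (fun=> c) 0.
Proof. by split; exact: is_derive_cst. Qed.

Lemma is_cderive_eq t F d d' : is_cderive t F d -> d = d' -> is_cderive t F d'.
Proof. by move=> H <-. Qed.

Lemma is_cderiveM t F G c d : is_cderive t F c -> is_cderive t G d ->
  is_cderive t (fun s => F s * G s) (c * G t + F t * d).
Proof.
move=> [F1 F2] [G1 G2]; rewrite /is_cderive.
have -> : (fun s => complex.Re (F s * G s)) = (fun s =>
  complex.Re (F s) * complex.Re (G s) - complex.Im (F s) * complex.Im (G s)).
  by apply/funext => s; case: (F s) (G s) => ? ? [].
have -> : (fun s => complex.Im (F s * G s)) = (fun s =>
  complex.Re (F s) * complex.Im (G s) + complex.Im (F s) * complex.Re (G s)).
  by apply/funext => s; case: (F s) (G s) => ? ? [].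
split.
  apply: (is_derive_eq (is_deriveB (is_deriveM F1 G1) (is_deriveM F2 G2))).
  clear; case: (F t) (G t) c d => [? ?] [? ?] [? ?] [? ?] /=.
  by rewrite /GRing.scale /=; ring.
apply: (is_derive_eq (is_deriveD (is_deriveM F1 G2) (is_deriveM F2 G1))).
clear; case: (F t) (G t) c d => [? ?] [? ?] [? ?] [? ?] /=.
by rewrite /GRing.scale /=; ring.
Qed.

Lemma is_cderiveD t F G c d : is_cderive t F c -> is_cderive t G d ->
  is_cderive t (fun s => F s + G s) (c + d).
Proof.
move=> [F1 F2] [G1 G2]; rewrite /is_cderive.
have -> : (fun s => complex.Re (F s + G s)) = (fun s =>
  complex.Re (F s) + complex.Re (G s)).
  by apply/funext => s; case: (F s) (G s) => ? ? [].
have -> : (fun s => complex.Im (F s + G s)) = (fun s =>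
  complex.Im (F s) + complex.Im (G s)).
  by apply/funext => s; case: (F s) (G s) => ? ? [].
split.
  apply: (is_derive_eq (is_deriveD F1 G1)).
  by clear; case: c d => [? ?] [? ?].
apply: (is_derive_eq (is_deriveD F2 G2)).
by clear; case: c d => [? ?] [? ?].
Qed.

Lemma is_cderive_sum t (r : seq nat) (P : pred nat) (F : nat -> R -> R[i])
    (d : nat -> R[i]) : (forall i, is_cderive t (F i) (d i)) ->
  is_cderive t (fun s => \sum_(i <- r | P i) F i s) (\sum_(i <- r | P i) d i).
Proof.
move=> H; elim: r => [|i r IH].
  by under eq_fun do rewrite big_nil; rewrite big_nil; exact: is_cderive_cst.
under eq_fun do rewrite big_cons; rewrite big_cons.
by case: (P i); [exact: is_cderiveD (H i) IH|exact: IH].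
Qed.

Lemma is_cderive_real t (g : R -> R) dg : is_derive t 1 g dg ->
  is_cderive t (fun s => (g s)%:C%C) dg%:C%C.
Proof. by move=> dG; split => //=; exact: is_derive_cst. Qed.

Lemma is_cderive_Cexp t (l : R[i]) :
  is_cderive t (fun s => Cexp (- l * s%:C%C)) (- l * Cexp (- l * t%:C%C)).
Proof.
case: l => a b.
have dlin (c : R) : is_derive t 1 (fun s : R => - c * s) (- c).
  have := is_deriveZ (- c) (is_derive_id t (1 : R)).
  by rewrite [_ *: 1]mulr1.
have dE := is_derive1_comp (is_derive_expR (- a * t)) (dlin a).
have dC := is_derive1_comp (is_derive_cos (- b * t)) (dlin b).
have dS := is_derive1_comp (is_derive_sin (- b * t)) (dlin b).
rewrite /is_cderive.
have E s : Cexp (- Complex a b * s%:C%C) = Complex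
  (expR (- a * s) * cos (- b * s)) (expR (- a * s) * sin (- b * s)).
  by rewrite /Cexp /= !mulr0 subr0 add0r.
split.
  under eq_fun do rewrite E /=.
  apply: (is_derive_eq (is_deriveM dE dC)).
  by rewrite E /GRing.scale /=; ring.
under eq_fun do rewrite E /=.
apply: (is_derive_eq (is_deriveM dE dS)).
by rewrite E /GRing.scale /=; ring.
Qed.

Lemma is_derive_real_form t F d (l : R[i]) : is_cderive t F d ->
  is_derive t 1 (fun s => real_form l (F s)) (real_form l d).
Proof.
by rewrite /real_form => -[d1 d2]; case: ifP => // _; exact: is_deriveN.
Qed.

End ComplexDerivative.

(** * The linear flow on Jordan chains in closed form *)

Section Evolution.
Context {R : realType} {n q : nat}.
Variables (lam : 'I_q -> R[i]) (m : 'I_q -> nat).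
Variables (jx : 'I_n -> 'I_q) (kx : 'I_n -> nat).
Hypothesis lam_inj : injective lam.
Hypothesis lam_conj : forall j, exists j', lam j' = conjc (lam j) /\ m j' = m j.
Hypothesis jkx : enumerates m jx kx.

(** This is e^{-t (lam + N)} applied to the chain, where N lowers the index by one; the exponential
    series of N stops where the chain begins. At [k = 0] the sum is empty and the value is 0, which
    lets the differential equation keep one form for all [k > 0]. *)
Definition evolved (z : 'I_q -> nat -> R[i]) (t : R) (j : 'I_q) (k : nat) : R[i] :=
  Cexp (- lam j * t%:C%C) *
  \sum_(0 <= i < k) ((- t) ^+ i / i`!%:R)%:C%C * z j (k - i)%N.

Lemma is_derive_exp_coeffN (t : R) i :
  is_derive t 1 (fun s : R => (- s) ^+ i / i`!%:R)
    (if i is i'.+1 then - ((- t) ^+ i' / i'`!%:R) else 0).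
Proof.
have dopp : is_derive t (1 : R) (-%R : R -> R) (-1) by exact: is_deriveNid.
case: i => [|i].
  under eq_fun do rewrite expr0; exact: is_derive_cst.
have dX := is_deriveX i.+1 dopp.
have dc := is_derive_cst ((i.+1)`!%:R^-1 : R) t (1 : R).
have -> : (fun s : R => (- s) ^+ i.+1 / i.+1`!%:R) =
    ((-%R : R -> R) ^+ i.+1 * cst (i.+1`!%:R^-1)).
  by apply/funext => s; rewrite !fctE.
have := is_deriveM dX dc; move/is_derive_eq; apply.
rewrite scaler0 add0r /GRing.scale /= factS natrM invfM.
have i0 : i.+1%:R != 0 :> R by rewrite pnatr_eq0.
by rewrite mulrN1 mulrN mulrACA mulVf // mul1r mulrC.
Qed.

(** Differentiating (-t)^i / i! gives minus the preceding coefficient, so the derivative of the sum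
    for [k] is minus the sum for [k.-1]; the factor [lam j] comes from the exponential. *)
Lemma is_cderive_evolved z (t : R) j k : (0 < k)%N ->
  is_cderive t (fun s => evolved z s j k)
    (- (lam j * evolved z t j k + evolved z t j k.-1)).
Proof.
case: k => // k _.
have dS : is_cderive t (fun s : R => \sum_(0 <= i < k.+1)
     ((- s) ^+ i / i`!%:R)%:C%C * z j (k.+1 - i)%N)
   (- \sum_(0 <= i < k) ((- t) ^+ i / i`!%:R)%:C%C * z j (k - i)%N).
  have := @is_cderive_sum R t (index_iota 0 k.+1) xpredT _ _ (fun i =>
    is_cderiveM (is_cderive_real (is_derive_exp_coeffN t i))
      (is_cderive_cst t (z j (k.+1 - i)%N))).
  move/is_cderive_eq; apply; rewrite big_nat_recl //= !mul0r mulr0 !add0r.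
  rewrite -sumrN; apply: eq_bigr => i _.
  by rewrite mulr0 addr0 subSS rmorphN mulNr.
have := is_cderiveM (is_cderive_Cexp t (lam j)) dS.
move/is_cderive_eq; apply.
by rewrite /evolved /= opprD mulrN !mulNr !mulrA.
Qed.

Lemma evolved_at0 z j k : (0 < k)%N -> evolved z 0 j k = z j k.
Proof.
case: k => // k _; rewrite /evolved mulr0 big_nat_recl // big_nat big1.
  rewrite addr0 oppr0 expr0 fact0 divr1 mul1r subn0.
  by rewrite /Cexp /= expR0 cos0 sin0 mulr1 mulr0 mul1r.
by move=> i _; rewrite oppr0 exprS !mul0r.
Qed.

Lemma Cexp_conjc (w : R[i]) : Cexp (conjc w) = conjc (Cexp w).
Proof. by case: w => a b; rewrite /Cexp /= cosN sinN mulrN. Qed.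

(** Needed in order to apply [real_jordan_mul] at every time and not only to the initial family. *)
Lemma evolved_conj z t : conj_family lam m z -> conj_family lam m (evolved z t).
Proof.
move=> zc j j' k e /andP[k0 km]; rewrite /evolved.
have cM (u w : R[i]) : conjc (u * w) = conjc u * conjc w by exact: rmorphM.
rewrite cM (big_morph conjc (rmorphD (@conjc R)) (rmorph0 (@conjc R))).
congr (_ * _).
  have -> : - lam j' * t%:C%C = conjc (- lam j * t%:C%C).
    rewrite e; case: (lam j) => a b; apply/eqP; rewrite eq_complex /=.
    by apply/andP; split; apply/eqP; ring.
  exact: Cexp_conjc.
rewrite !big_nat; apply: eq_bigr => i /andP[_ ik].
rewrite cM conjc_real (zc j) // subn_gt0 ik /=.
exact: leq_trans (leq_subr _ _) km.
Qed.

(** Uniqueness for the linear equation Y' = - L Y by an integrating factor: [expmx (s *: L) *m Y s]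
    has zero derivative, so it keeps its value at 0. *)
Lemma expmx_real_jordan z t : conj_family lam m z ->
  expmx (- t *: real_jordan lam jx kx) *m real_col lam jx kx z =
  real_col lam jx kx (evolved z t).
Proof.
move=> zc; set L := real_jordan _ _ _; set Y := fun s => real_col lam jx kx (evolved z s).
have [rng _ _] := jkx.
have dY (s : R) : is_derive s 1 Y (- (L *m Y s)).
  apply/is_derive_mxP => a b; 
  rewrite (real_jordan_mul lam_inj lam_conj jkx (evolved_conj s zc)).
  under eq_fun do rewrite mxE.
  rewrite mxE [X in - X]mxE -real_formN; apply: is_derive_real_form.
  apply: is_cderive_eq (is_cderive_evolved _ _ _ _) _.
    by have /andP[] := rng a.
  (* At the head of a chain the matrix contributes 0, in agreement with the empty sum of [evolved]
     at index 0. *)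
  congr (- (_ + _)); case: eqP => // ->.
  by rewrite /evolved big_geq // mulr0.
have cst s : expmx (s *: L) *m Y s = expmx (0 *: L) *m Y 0.
  apply/matrixP => a b.
  apply: (@is_derive_0_is_cst R (fun s => (expmx (s *: L) *m Y s) a b)) => r.
  have := is_derive_mulmx (is_derive_expmx L r) (dY r).
  rewrite (expmx_comm (A := L)) -?scalemxAl -?scalemxAr //.
  rewrite mulmxN mulmxA subrr => /is_derive_mxP /(_ a b).
  by rewrite mxE.
have Y0 : Y 0 = real_col lam jx kx z.
  apply/matrixP => a b; rewrite !mxE evolved_at0 //.
  by have /andP[] := rng a.
by rewrite -Y0 -[Y 0]mul1mx -(expmx0 L) -(cst t) mulmxA expmxK mul1mx.
Qed.

End Evolution.

(** * Gradients, Jacobians and Poisson brackets *)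

Section Gradients.
Context {R : realType} {n : nat}.
Local Notation E := 'cV[R]_n.
Local Notation phase := ('cV[R]_n * 'cV[R]_n)%type.

Lemma mulmx_col_ext m (A B : 'M[R]_(m, n)) :
  (forall v : E, A *m v = B *m v) -> A = B.
Proof.
move=> AB; apply/matrixP => i j; have := AB (delta_mx j 0).
by move/matrixP => /(_ i 0); rewrite -!colE !mxE.
Qed.

Lemma grad_mul (g : E -> R) (x v : E) : differentiable g x ->
  (grad g x *m v) 0 0 = 'd g x v.
Proof.
move=> dg; rewrite mxE [in RHS](matrix_sum_delta v) linear_sum.
apply: eq_bigr => i _; rewrite big_ord1 linearZ /= mxE deriveE //.
by rewrite mulrC.
Qed.

Lemma differentiable_mx_coord k (g : E -> 'cV[R]_k) x a :
  differentiable g x -> differentiable (fun y => g y a 0) x.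
Proof.
move=> dg; apply: (differentiable_comp (g := fun M : 'cV[R]_k => M a 0)) => //.
exact: differentiable_coord.
Qed.

Lemma Jac_mul k (g : E -> 'cV[R]_k) (x v : E) : differentiable g x ->
  Jac g x *m v = 'd g x v.
Proof.
move=> dg; apply/colP => a.
have -> : (Jac g x *m v) a 0 = (grad (fun y => g y a 0) x *m v) 0 0.
  by rewrite !mxE; apply: eq_bigr => i _; rewrite !mxE.
rewrite grad_mul; last exact: differentiable_mx_coord.
rewrite -!deriveE //; last exact: differentiable_mx_coord.
by rewrite derive_mx ?mxE //; exact: diff_derivable.
Qed.

Lemma grad_coord (g : E -> E) x a : grad (fun y => g y a 0) x = row a (Jac g x).
Proof. by apply/rowP => i; rewrite !mxE. Qed.

Lemma is_derive_Jac k (g : E -> 'cV[R]_k) x (A : 'M[R]_(k, n)) :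
  (forall v, is_derive x v g (A *m v)) -> Jac g x = A.
Proof.
move=> dg; apply/matrixP => i j.
have /is_derive_mxP /(_ i 0) [_ H] := dg (delta_mx j 0).
by rewrite mxE H -colE mxE.
Qed.

Lemma is_derive_grad (g : E -> R) x (A : 'rV[R]_n) :
  (forall v, is_derive x v g ((A *m v) 0 0)) -> grad g x = A.
Proof.
move=> dg; apply/rowP => j; have [_ H] := dg (delta_mx j 0).
by rewrite mxE H -colE mxE.
Qed.

Lemma is_derive_coord (V : normedModType R) k l (g : V -> 'M[R]_(k, l)) x v d a b :
  is_derive x v g d -> is_derive x v (fun y => g y a b) (d a b).
Proof. by move/is_derive_mxP. Qed.

Lemma is_derive_mulmxl (V : normedModType R) k l r (A : 'M[R]_(k, l))
    (g : V -> 'M[R]_(l, r)) x v d :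
  is_derive x v g d -> is_derive x v (fun y => A *m g y) (A *m d).
Proof.
move=> dg; have := is_derive_mulmx (is_derive_cst A x v) dg.
by rewrite mul0mx add0r.
Qed.

Lemma is_derive_mulmxr (V : normedModType R) k l r (A : 'M[R]_(l, r))
    (g : V -> 'M[R]_(k, l)) x v d :
  is_derive x v g d -> is_derive x v (fun y => g y *m A) (d *m A).
Proof.
move=> dg; have := is_derive_mulmx dg (is_derive_cst A x v).
by rewrite mulmx0 addr0.
Qed.

Lemma grad_tr_mul (c P : E) : grad (fun y => (y^T *m c) 0 0) P = c^T.
Proof.
apply: is_derive_grad => v.
have -> : (c^T *m v) 0 0 = (v^T *m c) 0 0.
  by rewrite -[in RHS](trmxK c) -trmx_mul [RHS]mxE.
apply: is_derive_coord; apply: is_derive_mulmxr; exact: is_derive_trmx.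
Qed.

Lemma grad_mul_fun (A : 'rV[R]_n) (g : E -> E) x : differentiable g x ->
  grad (fun y => (A *m g y) 0 0) x = A *m Jac g x.
Proof.
move=> dg; apply: is_derive_grad => v.
apply: is_derive_coord; rewrite -mulmxA Jac_mul //.
by apply: is_derive_mulmxl; exact: is_derive_diff.
Qed.

(** Collects all brackets of components into one matrix, so that the canonical relations become
    identities between Jacobians. *)
Lemma poisson_coord (G H : phase -> E) a b z :
  poisson (fun y => G y a 0) (fun y => H y b 0) z =
  (Jac (fun x => G (x, z.2)) z.1 *m (Jac (fun p => H (z.1, p)) z.2)^T
   - Jac (fun p => G (z.1, p)) z.2 *m (Jac (fun x => H (x, z.2)) z.1)^T) a b.
Proof.
rewrite /poisson.
rewrite (grad_coord (fun x => G (x, z.2))) (grad_coord (fun x => H (x, z.2))).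
rewrite (grad_coord (fun x => G (z.1, x))) (grad_coord (fun x => H (z.1, x))).
by rewrite !mxE; congr (_ - _); apply: eq_bigr => i _; rewrite !mxE.
Qed.

End Gradients.

(** * The linearizing diffeomorphism *)

Section TransportAlgebra.
Context {R : fieldType} {n : nat}.
Variables (A B J L M : 'M[R]_n).
Hypothesis variation : B + J *m A = L *m J.

(** With [A] the Jacobian of f, [B] the derivative of J along f and [M] the exponential of t L, the
    left side is the time derivative of P = M^T J^{-T} p along a Hamiltonian trajectory. The
    hypothesis [variation] rewrites J^{-1} B J^{-1} as J^{-1} L - A J^{-1}, and the terms cancel in
    pairs. *)
Lemma adjoint_momentum_transport (p : 'cV[R]_n) : J \in unitmx ->
  ((L *m M)^T *m (invmx J)^T + M^T *m (- (invmx J *m B *m invmx J))^T) *m p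
    + M^T *m (invmx J)^T *m - (A^T *m p) = 0.
Proof.
move=> uJ; have Bdef : B = L *m J - J *m A by rewrite -variation addrK.
have -> : invmx J *m B *m invmx J = invmx J *m L - A *m invmx J.
  rewrite Bdef mulmxBr mulmxBl -!mulmxA mulmxV // mulmx1 !mulmxA.
  by rewrite mulVmx // mul1mx.
rewrite mulmxN mulmxA -mulmxBl -!trmx_mul -!linearD -linearB /=.
by rewrite !mulmxA mulNmx mulmxBl opprB addrCA subrr addr0 subrr trmx0 mul0mx.
Qed.

(** The converse computation: with [M] the exponential of - t L and [P] held constant, the left side
    is the derivative of p = J^T M^T P, and it satisfies the adjoint equation. *)
Lemma momentum_transport (P : 'cV[R]_n) : L *m M = M *m L ->
  (B^T *m M^T + J^T *m (- (L *m M))^T) *m P = - (A^T *m (J^T *m M^T *m P)).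
Proof.
move=> LM; have := congr1 (fun Q => (M *m Q)^T *m P) variation.
rewrite mulmxDr raddfD /= mulmxDl mulmxDl LM raddfN /= mulmxN mulNmx.
rewrite !trmx_mul !mulmxA => <-.
by rewrite opprD addrA subrr add0r.
Qed.

End TransportAlgebra.

Section Linearization.
Context {R : realType} {n : nat}.
Local Notation E := 'cV[R]_n.
Local Notation phase := ('cV[R]_n * 'cV[R]_n)%type.
Variables (f Phi : E -> E) (L : 'M[R]_n) (Px : set E).
Hypothesis f_diff : forall x, differentiable f x.
Hypothesis Px_open : open Px.
Hypothesis Phi_C2 : forall a, Ck 2 Px (fun x => Phi x a 0).
Hypothesis Phi_diffeo : diffeo_onto_image Px Phi.
Hypothesis eigen : forall x, Px x -> Jac Phi x *m f x = L *m Phi x.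
Local Notation J := (Jac Phi).
Local Notation Et t := (expmx (t *: L)).

Lemma C1_Phi : C1 Px Phi.
Proof. by case: Phi_diffeo => cPhi _ _; exact: Ck1_C1. Qed.

Lemma Phi_diff x : Px x -> differentiable Phi x.
Proof. by move=> Pxx; exact: (C1_Phi Pxx).1. Qed.

Lemma C1_Jac : C1 Px J.
Proof.
apply: (C1_mx Px_open) => a i.
have -> : (fun x => J x a i) = 'D_(delta_mx i 0) (fun y => Phi y a 0).
  by apply/funext => x; rewrite mxE.
by apply: Ck1_C1 => //; exact: (Phi_C2 a).2.
Qed.

Lemma J_diff x : Px x -> differentiable J x.
Proof. by move=> Pxx; exact: (C1_Jac Pxx).1. Qed.

Lemma diff_left_inverse (h : E -> E) x v : Px x ->
  (forall y, Px y -> h (Phi y) = y) -> differentiable h (Phi x) ->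
  'd h (Phi x) ('d Phi x v) = v.
Proof.
move=> Pxx hK dh; have dP := Phi_diff Pxx.
have := diff_comp dP dh => /(congr1 (fun g : E -> E => g v)) /= <-.
have near_id : {near x, (h \o Phi) =1 id}.
  by apply: (open_near_eq Px_open Pxx) => y /hK.
have [_ <-] := diff_near_eq near_id (differentiable_comp dP dh).
by rewrite -deriveE // derive_id.
Qed.

(** The differentiable left inverse of [Phi] provides, by the chain rule, a left inverse of the
    square matrix [J x]. *)
Lemma J_unit x : Px x -> J x \in unitmx.
Proof.
move=> Pxx; have [_ oI [h ch hK]] := Phi_diffeo.
have dh : differentiable h (Phi x) by apply: ch.1; exists x.
have dP := Phi_diff Pxx.
suff : Jac h (Phi x) *m J x = 1%:M by case/mulmx1_unit.
apply: mulmx_col_ext => v; rewrite mul1mx -mulmxA !Jac_mul //.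
exact: diff_left_inverse.
Qed.

Lemma diff_Jac_coord x v a i : Px x ->
  'd J x v a i = 'D_v ('D_(delta_mx i 0) (fun y => Phi y a 0)) x.
Proof.
move=> Pxx; have dJ := J_diff Pxx.
rewrite -deriveE // derive_mx; last exact: diff_derivable.
rewrite mxE; congr ('D_v _ x); apply/funext => y.
by rewrite mxE.
Qed.

(** Columns of J are partial derivatives, so ['d J x v *m w] has [v] as outer direction. Schwarz
    against the basis vectors moves [v] inside, and summing over the coordinates of [w] yields a
    genuine iterated derivative, to which Schwarz applies once more in [diff_Jac_sym]. *)
Lemma diff_Jac_mul x v w a : Px x ->
  ('d J x v *m w) a 0 = 'D_w ('D_v (fun y => Phi y a 0)) x.
Proof.
move=> Pxx; rewrite mxE.
have dDv : differentiable ('D_v (fun y => Phi y a 0)) x.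
  exact: ((Phi_C2 a).2 v).1.
rewrite [RHS]deriveE // -grad_mul // mxE; apply: eq_bigr => i _.
congr (_ * _); apply: etrans (diff_Jac_coord v a i Pxx) _.
rewrite [RHS]mxE; exact: (schwarz _ _ Px_open (Phi_C2 a) Pxx).
Qed.

Lemma diff_Jac_sym x v w : Px x -> 'd J x v *m w = 'd J x w *m v.
Proof.
move=> Pxx; apply/colP => a; apply: etrans (diff_Jac_mul v w a Pxx) _.
apply: etrans (schwarz _ _ Px_open (Phi_C2 a) Pxx) _.
exact: esym (diff_Jac_mul w v a Pxx).
Qed.

(** Differentiating J f = L Phi in direction [v] puts [v] inside the derivative of J; symmetry of
    the Hessian exchanges it with [f x], and only then can [v] be removed to leave a matrix
    equation. *)
Lemma variational x : Px x -> 'd J x (f x) + J x *m Jac f x = L *m J x.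
Proof.
move=> Pxx; apply: mulmx_col_ext => v.
have d1 : is_derive x v (fun y => J y *m f y) ('d J x v *m f x + J x *m 'd f x v).
  by apply: is_derive_mulmx; apply: is_derive_diff => //; exact: J_diff.
have d2 : is_derive x v (fun y => L *m Phi y) (L *m 'd Phi x v).
  by apply: is_derive_mulmxl; apply: is_derive_diff; exact: Phi_diff.
have e : {near x, (fun y => J y *m f y) =1 (fun y => L *m Phi y)}.
  exact: (open_near_eq Px_open Pxx).
have := near_eq_derive v e; have [_ ->] := d1; have [_ ->] := d2.
rewrite mulmxDl -!mulmxA !(Jac_mul _ (Phi_diff Pxx)) (Jac_mul _ (f_diff x)).
by rewrite (diff_Jac_sym _ _ Pxx).
Qed.

(** * The Hamilton-Jacobi equation and uniqueness along characteristics *)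

Definition Wbar (x P : E) (t : R) : R :=
  (P^T *m expmx (- t *: L) *m Phi x) 0 0.

Lemma grad_Wbar_x P t x : Px x ->
  grad (fun y => Wbar y P t) x = P^T *m Et (- t) *m J x.
Proof. by move=> Pxx; apply: grad_mul_fun; exact: Phi_diff. Qed.

Lemma grad_Wbar_P P t x :
  grad (fun Q => Wbar x Q t) P = (Et (- t) *m Phi x)^T.
Proof.
rewrite -(grad_tr_mul _ P); congr (grad _ P); apply/funext => Q.
by rewrite /Wbar mulmxA.
Qed.

Lemma is_derive_Wbar_t P (t : R) x : is_derive t 1 (fun s => Wbar x P s)
  (- (P^T *m Et (- t) *m (L *m Phi x)) 0 0).
Proof.
have -> : - (P^T *m Et (- t) *m (L *m Phi x)) 0 0 =
    (P^T *m (- (L *m Et (- t))) *m Phi x) 0 0.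
  by rewrite scale_expmx_comm mulmxN mulNmx [in RHS]mxE !mulmxA.
apply: is_derive_coord; apply: is_derive_mulmxr; apply: is_derive_mulmxl.
exact: is_derive_expmxN.
Qed.

Lemma Wbar_HJ P t x : Px x ->
  H0 f x (grad (fun y => Wbar y P t) x)^T + derive1 (fun s => Wbar x P s) t = 0.
Proof.
move=> Pxx; rewrite derive1E; have [_ ->] := is_derive_Wbar_t P t x.
by rewrite /H0 trmxK grad_Wbar_x // -[in X in X - _]mulmxA eigen // subrr.
Qed.

Lemma Wbar0 P x : Wbar x P 0 = (P^T *m Phi x) 0 0.
Proof. by rewrite /Wbar oppr0 expmx0 mulmx1. Qed.

Lemma C1_Wbar P : C1 (Px `*` [set: R]) (fun z => Wbar z.1 P z.2).
Proof.
have oD := @open_cylinder R E R _ Px_open.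
apply: (C1_coord 0 0 oD); apply: (C1_mulmx oD).
  apply: (C1_mulmx oD); first exact: C1_cst.
  apply: (@C1_comp _ _ _ _ _ setT (fun z : E * R => - z.2) (fun t => Et t) oD) => //.
    have -> : (fun z : E * R => - z.2) = (fun z => (-1 : R) *: z.2).
      by apply/funext => z; rewrite scaleN1r.
    apply: (@C1_comp _ _ _ _ _ setT (@snd E R) ( *:%R (-1 : R)) oD) => //.
      exact: C1_snd.
    by apply: C1_lin; exact: scaler_continuous.
  exact: C1_expmx.
apply: (@C1_comp _ _ _ _ _ Px (@fst E R) Phi oD) => //.
- by move=> z [].
- exact: C1_fst.
- exact: C1_Phi.
Qed.

Lemma Wbar_HJ_solution P :
  HJ_solution (H0 f) (Px `*` setT) (fun z => Wbar z.1 P z.2).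
Proof.
split; first by apply: C1_Ck1; [exact: open_cylinder|exact: C1_Wbar].
by move=> x t [Pxx _]; exact: Wbar_HJ.
Qed.

(** Since [H0] is linear in p, the Hamilton-Jacobi equation is a transport equation: its left side
    is the derivative of [W] in direction (f, 1), the velocity of (c(s), s). *)
Lemma characteristic_derive (W : E * R -> R) (D : set (E * R)) (c : R -> E) (s : R) :
  open D -> HJ_solution (H0 f) D W -> D (c s, s) ->
  is_derive s 1 c (f (c s)) -> is_derive s 1 (fun r => W (c r, r)) 0.
Proof.
move=> oD [[dW _] hj] Ds dc.
have dWs := dW _ Ds.
have dp : is_derive s 1 (fun r => (c r, r)) (f (c s), 1).
  have dc' : differentiable c s by apply/derivable1_diffP; case: dc.
  have did : differentiable (fun r : R => r) s by [].
  have dp : differentiable (fun r => (c r, r)) s by exact: differentiable_pair.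
  split; first exact/derivable1_diffP.
  rewrite deriveE // diff_pair // -deriveE //; have [_ ->] := dc.
  by rewrite diff_idE.
have := is_derive_comp dp dWs; move/is_derive_eq; apply.
have -> : (f (c s), 1 : R) = (f (c s), 0) + (0, 1).
  by congr pair; rewrite ?addr0 ?add0r.
rewrite linearD /=; apply: etrans (hj _ _ Ds); rewrite /H0 trmxK derive1E.
have [dWx dWxE] := diff_partial1 dWs; have [dWt dWtE] := diff_partial2 dWs.
by rewrite (grad_mul _ dWx) dWxE deriveE // dWtE.
Qed.


(** Both functions are constant along the graph of [c] between times 0 and [t], and they agree at
    time 0. Requiring the graph to lie in [D] replaces any assumption that trajectories exist
    globally. *)
Lemma Wbar_unique P (D : set (E * R)) (W : E * R -> R) (c : R -> E) (t : R) :
  open D -> D `<=` Px `*` setT -> HJ_solution (H0 f) D W ->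
  (forall x, D (x, 0) -> W (x, 0) = (P^T *m Phi x) 0 0) ->
  (forall s, Num.min 0 t <= s <= Num.max 0 t ->
     D (c s, s) /\ is_derive s 1 c (f (c s))) ->
  W (c t, t) = Wbar (c t) P t.
Proof.
move=> oD DP WS W0 ct.
have zero_in : Num.min 0 t <= 0 <= Num.max 0 t by rewrite ge_min le_max lexx.
have -> : W (c t, t) = W (c 0, 0).
  apply: (@is_derive0_const R (fun r => W (c r, r))) => s /ct[Ds dc].
  exact: characteristic_derive oD WS Ds dc.
have -> : Wbar (c t) P t = Wbar (c 0) P 0.
  apply: (@is_derive0_const R (fun r => Wbar (c r) P r)) => s /ct[/DP Ds dc].
  exact: (characteristic_derive (open_cylinder Px_open) (Wbar_HJ_solution P) Ds dc).
by rewrite W0 ?Wbar0 //; have [] := ct 0 zero_in.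
Qed.

(** Obtained by solving p = dW/dx and X = dW/dP for (X, P). The second component is the inverse
    transpose of the Jacobian of the first, applied to p. *)
Definition action_map (t : R) (z : phase) : phase :=
  (Et (- t) *m Phi z.1, (Et t)^T *m (invmx (J z.1))^T *m z.2).

Local Notation T := action_map.

Lemma generated_byP t x p X P : Px x ->
  generated_by Wbar t x p X P <-> T t (x, p) = (X, P).
Proof.
move=> Pxx; rewrite /generated_by grad_Wbar_x // grad_Wbar_P trmxK /T /=.
have uJ := J_unit Pxx; split.
  move=> [-> ->]; congr pair.
  rewrite !trmx_mul trmxK !mulmxA -[_ *m (invmx (J x))^T *m _]mulmxA -trmx_mul.
  by rewrite mulmxV // trmx1 mulmx1 -trmx_mul expmxK trmx1 mul1mx.
move=> [<- <-]; split=> //; rewrite !trmx_mul trmxK.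
rewrite !mulmxA -(mulmxA _ (Et (- t))^T) -trmx_mul expmxNK.
by rewrite trmx1 mulmx1 !trmxK -trmx_mul mulVmx // trmx1 mul1mx.
Qed.

Lemma C1_action_map t : C1 (Px `*` setT) (T t).
Proof.
have oD := @open_cylinder R E E _ Px_open.
have c1 : C1 (Px `*` [set: E]) (fun z => Phi z.1).
  apply: (@C1_comp _ _ _ _ _ Px (@fst E E) Phi oD); first by move=> z [].
    exact: C1_fst.
  exact: C1_Phi.
have cJ : C1 (Px `*` [set: E]) (fun z => J z.1).
  apply: (@C1_comp _ _ _ _ _ Px (@fst E E) J oD); first by move=> z [].
    exact: C1_fst.
  exact: C1_Jac.
apply: (C1_pair oD); first exact: C1_mulmx oD (C1_cst _) c1.
apply: (C1_mulmx oD); last exact: C1_snd.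
apply: (C1_mulmx oD (C1_cst _)); apply: (C1_trmx oD).
by apply: (C1_invmx oD _ cJ) => z [Pz _]; exact: J_unit.
Qed.

(** Over each [x] the map from p to P is a linear bijection, so the image constrains the position
    only; its openness then follows from that of the image of [Phi]. *)
Lemma action_map_image t :
  T t @` (Px `*` setT) = [set Z : phase | (Phi @` Px) (Et t *m Z.1)].
Proof.
apply/seteqP; split => [_ [[x p] [/= Pxx _] <-]|[X P] /= [x Pxx e]].
  by exists x; rewrite //= mulmxA expmxNK mul1mx.
exists (x, (P^T *m Et (- t) *m J x)^T); first by split.
apply/generated_byP => //; split; first by rewrite grad_Wbar_x.
by rewrite grad_Wbar_P trmxK e mulmxA expmxK mul1mx.
Qed.

Lemma action_map_diffeo t : diffeo_onto_image (Px `*` setT) (T t).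
Proof.
have oD := @open_cylinder R E E _ Px_open.
have [cPhi oI [h ch hK]] := Phi_diffeo.
have oT : open (T t @` (Px `*` setT)).
  rewrite action_map_image.
  rewrite (_ : [set _ | _] = (fun Z : phase => Et t *m Z.1) @^-1` (Phi @` Px)) //.
  apply: open_comp => // Z _.
  apply: (continuous_comp (f := @fst E E) (g := fun X => Et t *m X)).
    exact: cvg_fst.
  exact: continuous_mulmxl.
split=> //; first exact: C1_Ck1 oD (C1_action_map t).
pose g (Z : phase) : E := h (Et t *m Z.1).
have inI (Z : phase) : (T t @` (Px `*` setT)) Z -> (Phi @` Px) (Et t *m Z.1).
  by rewrite action_map_image.
have gPx Z : (T t @` (Px `*` setT)) Z -> Px (g Z).
  by move/inI => [x Pxx e]; rewrite /g -e hK.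
have cg : C1 (T t @` (Px `*` setT)) g.
  apply: (@C1_comp _ _ _ _ _ (Phi @` Px) (fun Z : phase => Et t *m Z.1) h oT) => //.
    by apply: (C1_mulmx oT (C1_cst _)); exact: C1_fst.
  exact: Ck1_C1.
(* The inverse recovers x by [h], after undoing the exponential, and then p as the gradient of the
   generating function. *)
exists (fun Z => (g Z, (J (g Z))^T *m (Et (- t))^T *m Z.2)).
  apply: (C1_Ck1 oT); apply: (C1_pair oT cg).
  apply: (C1_mulmx oT); last exact: C1_snd.
  apply: (C1_mulmx oT); last exact: C1_cst.
  apply: (C1_trmx oT).
  exact: (@C1_comp _ _ _ _ _ Px g J oT gPx cg C1_Jac).
move=> [x p] [/= Pxx _].
have gx : g (T t (x, p)) = x by rewrite /g /= mulmxA expmxNK mul1mx hK.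
rewrite gx; congr pair.
rewrite /= !mulmxA -(mulmxA _ (Et (- t))^T) -trmx_mul expmxNK.
by rewrite trmx1 mulmx1 -trmx_mul mulVmx ?J_unit // trmx1 mul1mx.
Qed.


(** * Jacobians and Poisson brackets of the action map *)

Lemma is_derive_invJ x v : Px x ->
  is_derive x v (fun y => invmx (J y))
    (- (invmx (J x) *m 'd J x v *m invmx (J x))).
Proof.
move=> Pxx; have uJ := J_unit Pxx.
have di : differentiable (fun y => invmx (J y)) x.
  exact: (C1_invmx Px_open J_unit C1_Jac Pxx).1.
have d1 := is_derive_mulmx (is_derive_diff v di) (is_derive_diff v (J_diff Pxx)).
have near1 : {near x, (fun y => invmx (J y) *m J y) =1 cst 1%:M}.
  by apply: (open_near_eq Px_open Pxx) => y /J_unit uy; rewrite mulVmx.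
have := near_eq_derive v near1; have [_ ->] := d1.
rewrite derive_cst => /eqP; rewrite addr_eq0 => /eqP e.
apply: is_derive_eq (is_derive_diff v di) _.
rewrite -[LHS]mulmx1 -(mulmxV uJ) mulmxA.
by rewrite [X in X *m _ = _]e mulNmx.
Qed.

Lemma Jac_position_x t x p : Px x ->
  Jac (fun y => (T t (y, p)).1) x = Et (- t) *m J x.
Proof.
move=> Pxx; apply: is_derive_Jac => v; rewrite -mulmxA.
apply: is_derive_mulmxl; rewrite (Jac_mul _ (Phi_diff Pxx)).
exact: is_derive_diff (Phi_diff Pxx).
Qed.

Lemma Jac_position_p t x p : Jac (fun r => (T t (x, r)).1) p = 0.
Proof.
apply: is_derive_Jac => v; rewrite mul0mx.
exact: (is_derive_cst (Et (- t) *m Phi x) p v).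
Qed.

Lemma Jac_momentum_p t x p :
  Jac (fun r => (T t (x, r)).2) p = (invmx (J x) *m Et t)^T.
Proof.
apply: is_derive_Jac => v; rewrite trmx_mul.
exact: (is_derive_mulmxl ((Et t)^T *m (invmx (J x))^T) (is_derive_id p v)).
Qed.

(** Stated against a vector because the derivative of J is a third-order object, handled here
    through its directional values ['d J x v]. *)
Lemma Jac_momentum_x t x p v : Px x ->
  Jac (fun y => (T t (y, p)).2) x *m v =
  - ((invmx (J x) *m Et t)^T *m ('d J x v)^T *m ((invmx (J x))^T *m p)).
Proof.
move=> Pxx.
have Dxp : (Px `*` [set: E]) (x, p) by [].
have dT : differentiable (T t) (x, p) by exact: (C1_action_map t Dxp).1.
have [dTx _] := diff_partial1 dT.
have d2 : differentiable (fun y => (T t (y, p)).2) x.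
  by apply: (differentiable_comp (g := @snd E E) dTx); exact: (@C1_snd R E E setT _ I).1.
rewrite (Jac_mul _ d2) -deriveE //.
have dinv := is_derive_trmx (is_derive_invJ v Pxx).
have [_ ->] := is_derive_mulmxr p (is_derive_mulmxl (Et t)^T dinv).
by rewrite !trmx_mul linearN /= mulmxN mulNmx !trmx_mul !mulmxA.
Qed.

Lemma poisson_positions t a b z :
  poisson (fun y => (T t y).1 a 0) (fun y => (T t y).1 b 0) z = 0.
Proof.
rewrite (poisson_coord (fun y => (T t y).1) (fun y => (T t y).1)).
by rewrite !Jac_position_p trmx0 mulmx0 mul0mx subrr mxE.
Qed.

Lemma poisson_position_momentum t a b z : Px z.1 ->
  poisson (fun y => (T t y).1 a 0) (fun y => (T t y).2 b 0) z = (a == b)%:R.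
Proof.
move=> Pz; rewrite (poisson_coord (fun y => (T t y).1) (fun y => (T t y).2)).
rewrite Jac_position_p mul0mx subr0 Jac_position_x // Jac_momentum_p trmxK.
rewrite mulmxA -[_ *m J z.1 *m _]mulmxA mulmxV ?J_unit // mulmx1 expmxK.
by rewrite mxE.
Qed.

(** The bracket matrix is K M - (K M)^T, so it vanishes once K M is symmetric. The claim [KM] shows
    its entries to be a Hessian, contracted with [q] and evaluated on two columns of [M]. *)
Lemma poisson_momenta t a b z : Px z.1 ->
  poisson (fun y => (T t y).2 a 0) (fun y => (T t y).2 b 0) z = 0.
Proof.
move=> Pz; rewrite (poisson_coord (fun y => (T t y).2) (fun y => (T t y).2)).
rewrite Jac_momentum_p trmxK; set M := invmx _ *m _; set K := Jac _ _.
set q := (invmx (J z.1))^T *m z.2.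
have KM c d : (K *m M) c d = - (q^T *m ('d J (z.1) (col d M) *m col c M)) 0 0.
  have -> : (K *m M) c d = (K *m col d M) c 0.
    by rewrite !mxE; apply: eq_bigr => i _; rewrite !mxE.
  rewrite Jac_momentum_x // -/M -/q mxE; congr (- _).
  rewrite [RHS](_ : _ = (q^T *m ('d J (z.1) (col d M) *m col c M))^T 0 0).
    rewrite [in RHS]trmx_mul [in RHS](trmx_mul ('d J (z.1) (col d M))) trmxK.
    by rewrite tr_col -!row_mul [RHS]mxE.
  by rewrite [RHS]mxE.
rewrite -trmx_mul mxE [X in _ + X]mxE [(_^T) a b]mxE !KM.
by rewrite (diff_Jac_sym _ _ Pz) subrr.
Qed.

Lemma grad_H0_x x p : grad (fun x' => H0 f x' p) x = p^T *m Jac f x.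
Proof. exact: grad_mul_fun. Qed.

Lemma grad_H0_p x p : grad (fun p' => H0 f x p') p = (f x)^T.
Proof. exact: grad_tr_mul. Qed.

(** The right side is minus the derivative of P_a with respect to its explicit time, which is what
    makes P_a a first integral. *)
Lemma poisson_momentum_H0 t a z : Px z.1 ->
  poisson (fun y => (T t y).2 a 0) (fun y => H0 f y.1 y.2) z =
  - ((Et t)^T *m L^T *m ((invmx (J z.1))^T *m z.2)) a 0.
Proof.
move=> Pz; rewrite /poisson grad_H0_x grad_H0_p trmxK trmx_mul trmxK.
rewrite (grad_coord (fun y => (T t (y, z.2)).2)).
rewrite (grad_coord (fun y => (T t (z.1, y)).2)) Jac_momentum_p.
rewrite -!row_mul -raddfB /= mxE Jac_momentum_x // -mulmxA.
(* Writing p as J^T q makes both halves of the bracket act on [q], where they add up to the left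
   side of [variational]. *)
set q := _ *m z.2; have -> : z.2 = (J z.1)^T *m q.
  by rewrite mulmxA -trmx_mul mulVmx ?J_unit // trmx1 mul1mx.
rewrite -opprD mxE -!mulmxA -mulmxDr; congr (- _); congr (fun_of_matrix _ a 0).
rewrite [(Jac f _)^T *m _]mulmxA -trmx_mul -mulmxDl -linearD /= variational //.
rewrite trmx_mul -!mulmxA trmx_mul -!mulmxA; congr (_ *m _).
by rewrite mulmxA -trmx_mul mulmxV ?J_unit // trmx1 mul1mx.
Qed.

Lemma action_map_canonical t : canonical_coordinates (Px `*` setT) (T t).
Proof.
split; first exact: action_map_diffeo.
move=> a b z [Pz _]; split; first exact: poisson_positions.
- exact: poisson_momenta.
- exact: poisson_position_momentum.
Qed.

Lemma momenta_completely_integrable :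
  completely_integrable_by (Px `*` setT) (H0 f) (fun t z => (T t z).2).
Proof.
move=> t; split.
- apply: C1_Ck1; first exact: open_cylinder.
  apply: (@C1_comp _ _ _ _ _ setT (T t) (@snd E E)) => //.
  + exact: open_cylinder.
  + exact: C1_action_map.
  + exact: C1_snd.
- move=> a z [Pz _]; rewrite poisson_momentum_H0 // opprK.
  apply: is_derive_coord; rewrite -trmx_mul mulmxA.
  apply: is_derive_mulmxr; apply: is_derive_mulmxr; apply: is_derive_trmx.
  exact: is_derive_expmx.
- by move=> a b z [Pz _]; exact: poisson_momenta.
- move=> x p [Pxx _]; rewrite Jac_momentum_p.
  set K := Jac _ _; set M := invmx _ *m _.
  apply/eqP; rewrite -[_ == _]/(row_free _); apply/row_freeP.
  have uM : M^T \in unitmx.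
    rewrite unitmx_tr unitmx_mul unitmx_inv J_unit //=.
    by case/mulmx1_unit: (expmxK L t).
  (* Full rank is already visible in the p-block: the right inverse is zero on the x-block. *)
  exists (col_mx 0 (invmx M^T)); rewrite mul_row_col mulmx0 add0r.
  exact: mulmxV.
Qed.


(** * Hamilton's equations in the new coordinates *)

Lemma hamiltonian_solutionE (I : set R) (x p : R -> E) :
  hamiltonian_solution (H0 f) I x p <->
  forall s, I s -> is_derive s 1 x (f (x s)) /\
    is_derive s 1 p (- ((Jac f (x s))^T *m p s)).
Proof.
split=> H s Is; have := H s Is;
  by rewrite grad_H0_p grad_H0_x trmxK trmx_mul trmxK.
Qed.

Lemma momentumK t x p : Px x ->
  p = (J x)^T *m (Et (- t))^T *m (T t (x, p)).2.
Proof.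
move=> Pxx; rewrite /= !mulmxA -(mulmxA _ (Et (- t))^T) -trmx_mul.
by rewrite expmxNK trmx1 mulmx1 -trmx_mul mulVmx ?J_unit // trmx1 mul1mx.
Qed.

Lemma hamiltonian_derive0 (x p : R -> E) (s : R) : Px (x s) ->
  is_derive s 1 x (f (x s)) -> is_derive s 1 p (- ((Jac f (x s))^T *m p s)) ->
  is_derive s 1 (fun t => (T t (x t, p t)).1) 0 /\
  is_derive s 1 (fun t => (T t (x t, p t)).2) 0.
Proof.
move=> Ps dx dp; have uJ := J_unit Ps; split.
  have dPhi := is_derive_comp dx (Phi_diff Ps).
  have := is_derive_mulmx (is_derive_expmxN L s) dPhi.
  move/is_derive_eq; apply.
  rewrite -(Jac_mul _ (Phi_diff Ps)) (eigen Ps) scale_expmx_comm mulNmx mulmxA.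
  by rewrite addNr.
have di : differentiable (fun y => invmx (J y)) (x s).
  exact: (C1_invmx Px_open J_unit C1_Jac Ps).1.
have dinv : is_derive s 1 (fun t => invmx (J (x t)))
    (- (invmx (J (x s)) *m 'd J (x s) (f (x s)) *m invmx (J (x s)))).
  have := is_derive_comp dx di; move/is_derive_eq; apply.
  have [_ e] := is_derive_invJ (f (x s)) Ps.
  exact: etrans (esym (deriveE _ di)) e.
have := is_derive_mulmx (is_derive_mulmx (is_derive_trmx (is_derive_expmx L s))
  (is_derive_trmx dinv)) dp.
move/is_derive_eq; apply.
exact: adjoint_momentum_transport (variational Ps) _ uJ.
Qed.

(** Neither [x] nor [p] is known to be differentiable, so both are rebuilt near [s] from X and P by
    the inverse formulas and the rebuilt curves are differentiated. Openness of [I] makes these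
    formulas hold on a neighbourhood of [s]. *)
Lemma derive0_hamiltonian (I : set R) (x p : R -> E) (s : R) : open I ->
  (forall r, I r -> Px (x r)) -> I s ->
  is_derive s 1 (fun t => (T t (x t, p t)).1) 0 ->
  is_derive s 1 (fun t => (T t (x t, p t)).2) 0 ->
  is_derive s 1 x (f (x s)) /\ is_derive s 1 p (- ((Jac f (x s))^T *m p s)).
Proof.
move=> oI IP Is dX dP; have Ps := IP s Is; have uJ := J_unit Ps.
have [_ _ [h ch hK]] := Phi_diffeo.
have dh : differentiable h (Phi (x s)) by apply: ch.1; exists (x s).
have XE r : Et r *m (T r (x r, p r)).1 = Phi (x r).
  by rewrite /= mulmxA expmxNK mul1mx.
have dx : is_derive s 1 x (f (x s)).
  have near_x : {near s, (fun r => h (Et r *m (T r (x r, p r)).1)) =1 x}.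
    by apply: (open_near_eq oI Is) => r Ir; rewrite XE hK //; exact: IP.
  apply: (near_eq_is_derive near_x).
  have dY := is_derive_mulmx (is_derive_expmx L s) dX.
  have dh' : differentiable h (Et s *m (T s (x s, p s)).1) by rewrite XE.
  have := is_derive_comp dY dh'; move/is_derive_eq; apply.
  rewrite mulmx0 addr0 -mulmxA XE -(eigen Ps) (Jac_mul _ (Phi_diff Ps)).
  exact: diff_left_inverse.
split=> //.
have near_p : {near s, (fun r => (J (x r))^T *m (Et (- r))^T *m (T r (x r, p r)).2) =1 p}.
  by apply: (open_near_eq oI Is) => r Ir; rewrite -momentumK //; exact: IP.
apply: (near_eq_is_derive near_p).
have dJ := is_derive_trmx (is_derive_comp dx (J_diff Ps)).
have := is_derive_mulmx (is_derive_mulmx dJ (is_derive_trmx (is_derive_expmxN L s))) dP.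
move/is_derive_eq; apply; rewrite mulmx0 addr0.
rewrite [in RHS](momentumK s (p s) Ps).
exact: momentum_transport (variational Ps) _ (scale_expmx_comm _ _).
Qed.

End Linearization.

(** * Koopman eigenfunctions *)

Section Eigenfunctions.
Context {R : realType} {n q : nat}.
Variables (f : 'cV[R]_n -> 'cV[R]_n) (Px : set 'cV[R]_n).
Variables (lam : 'I_q -> R[i]) (m : 'I_q -> nat).
Variables (phi : 'I_q -> nat -> 'cV[R]_n -> R[i]).
Variables (jx : 'I_n -> 'I_q) (kx : 'I_n -> nat).
Hypothesis Px_open : open Px.
Hypothesis lam_inj : injective lam.
Hypothesis lam_conj : forall j, exists j', lam j' = conjc (lam j) /\ m j' = m j.
Hypothesis jkx : enumerates m jx kx.
Hypothesis phi_C2 : forall j k, (1 <= k <= m j)%N -> CkC 2 Px (phi j k).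
Hypothesis phi_eigen :
  forall j, generalized_eigenfunctions f Px (lam j) (m j) (phi j).
Hypothesis phi_conj : conjugation_stable Px lam m phi.
Local Notation Phi := (Phi_vec lam jx kx phi).

Lemma Phi_vec_conj_family x : Px x -> conj_family lam m (fun j k => phi j k x).
Proof. by move=> Pxx j j' k e km; exact: phi_conj. Qed.

Lemma Phi_vec_C2 a : Ck 2 Px (fun x => Phi x a 0).
Proof.
have [rng _ _] := jkx; have [cRe cIm] := phi_C2 (rng a).
under eq_fun do rewrite mxE /real_form.
by case: (0 <= _); [exact: cRe|exact: CkN].
Qed.

(** The generator acts separately on real and imaginary parts, hence commutes with [real_form]. *)
Lemma Phi_vec_generator a x : Px x ->
  (Jac Phi x *m f x) a 0 =
  real_form (lam (jx a)) (koopman_generator f (phi (jx a) (kx a)) x).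
Proof.
move=> Pxx; have [rng _ _] := jkx; have [cRe cIm] := phi_C2 (rng a).
have -> : (Jac Phi x *m f x) a 0 = (grad (fun y => Phi y a 0) x *m f x) 0 0.
  by rewrite grad_coord -row_mul [RHS]mxE.
rewrite /real_form; under eq_fun do rewrite mxE /real_form.
case: (0 <= _) => //=.
have dIm := cIm.1 _ Pxx; rewrite !grad_mul //; last exact: differentiableN.
by rewrite (diffN dIm).
Qed.

Lemma Phi_vec_eigen x : Px x -> Jac Phi x *m f x = real_jordan lam jx kx *m Phi x.
Proof.
move=> Pxx; have [rng _ _] := jkx.
apply: etrans (esym (real_jordan_mul lam_inj lam_conj jkx (Phi_vec_conj_family Pxx))).
apply/colP => a; rewrite Phi_vec_generator // mxE; congr real_form.
have [e1 ek] := phi_eigen (jx a); case: eqP => [->|k1]; first by rewrite addr0 e1.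
apply: ek => //; have /andP[k0 ->] := rng a; rewrite andbT.
by case: (kx a) k0 k1 => [|[]].
Qed.

(** A Kronecker delta summed over components is inserted, and the sums are exchanged; surjectivity
    and injectivity of the enumeration are used in the first step, the index range in the second. *)
Lemma sum_enumerates (W : nmodType) (F : 'I_q -> nat -> W) :
  \sum_j \sum_(1 <= k < (m j).+1) F j k = \sum_a F (jx a) (kx a).
Proof.
have [rng inj sur] := jkx.
transitivity (\sum_j \sum_(1 <= k < (m j).+1)
    \sum_a F (jx a) (kx a) *+ ((j == jx a) && (k == kx a))).
  apply: eq_bigr => j _; rewrite !big_nat; apply: eq_bigr => k km.
  have [a [<- <-]] := sur j k km.
  rewrite -[LHS](sum_index jkx (fun b => F (jx b) (kx b)) a).
  by apply: eq_bigr => b _; rewrite (eq_sym (jx b)) (eq_sym (kx b)).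
under eq_bigr do rewrite exchange_big.
rewrite exchange_big; apply: eq_bigr => a _ /=.
rewrite (bigD1 (jx a)) //= [X in _ + X]big1 ?addr0 => [|j /negPf ja].
  rewrite (bigD1_seq (kx a)) ?iota_uniq ?mem_index_iota ?rng //= !eqxx.
  by rewrite big1 ?addr0 // => k /negPf ->.
by rewrite big1 // => k _; rewrite ja.
Qed.

Lemma span_Phi_vec (z : 'I_q -> nat -> R[i]) (Pjk : 'I_q -> nat -> R) :
  ((\col_(a < n) Pjk (jx a) (kx a))^T *m real_col lam jx kx z) 0 0 =
  \sum_j \sum_(1 <= k < (m j).+1) Pjk j k * real_form (lam j) (z j k).
Proof.
rewrite (sum_enumerates (fun j k => Pjk j k * real_form (lam j) (z j k))) mxE.
by apply: eq_bigr => a _; rewrite !mxE.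
Qed.

(** The term [i = 0] of [evolved] is split off, and the heads of chains are separated from the rest.
    The remaining terms follow the chain down to index 1 with alternating signs; a single term t
    e^{-lam t} phi^{k-1} would in general not match [e^{-t Lambda} Phi]. *)
Lemma Wbar_explicit (m_gt0 : forall j, (0 < m j)%N) (Pjk : 'I_q -> nat -> R) x t :
  Px x ->
  Wbar Phi (real_jordan lam jx kx) x (\col_(a < n) Pjk (jx a) (kx a)) t =
  \sum_(j < q) Pjk j 1%N *
    real_form (lam j) (Cexp (- lam j * t%:C%C) * phi j 1%N x)
  + \sum_(j < q) \sum_(2 <= k < (m j).+1) Pjk j k *
    real_form (lam j)
      (Cexp (- lam j * t%:C%C) * phi j k x
       + \sum_(1 <= i < k) ((- t) ^+ i / i`!%:R)%:C%C *
           Cexp (- lam j * t%:C%C) * phi j (k - i)%N x).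
Proof.
move=> Pxx; rewrite /Wbar -mulmxA.
have := expmx_real_jordan lam_inj lam_conj jkx t (Phi_vec_conj_family Pxx).
move=> ->; rewrite span_Phi_vec -big_split; apply: eq_bigr => j _ /=.
have ev k : (0 < k)%N -> evolved lam (fun j k => phi j k x) t j k =
    Cexp (- lam j * t%:C%C) * phi j k x
       + \sum_(1 <= i < k) ((- t) ^+ i / i`!%:R)%:C%C *
           Cexp (- lam j * t%:C%C) * phi j (k - i)%N x.
  move=> k0; rewrite /evolved big_ltn // mulrDr expr0 divr1 mul1r subn0.
  congr (_ + _); rewrite mulr_sumr; apply: eq_bigr => i _.
  by rewrite mulrA [Cexp _ * _]mulrC.
rewrite big_ltn ?ltnS // ev // (@big_geq _ _ _ 1 1) // addr0; congr (_ + _).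
rewrite !big_nat; apply: eq_bigr => k /andP[k2 _]; rewrite ev //.
exact: ltnW.
Qed.

End Eigenfunctions.

Theorem proposition3 (R : realType) (n q : nat)
  (f : 'cV[R]_n -> 'cV[R]_n)
  (f_smooth : smooth f) (f0 : f 0 = 0)
  (hyperbolic : forall z : R[i],
     eigenvalue (complexify (Jac f 0)) z -> complex.Re z != 0)
  (lam : 'I_q -> R[i]) (m : 'I_q -> nat)
  (spectrum : nonderogatory_spectrum (Jac f 0) lam m)
  (Px : set 'cV[R]_n)
  (Px_open : open Px) (Px_connected : connected Px) (Px0 : Px 0)
  (phi : 'I_q -> nat -> 'cV[R]_n -> R[i])
  (phi_C2 : forall j k, (1 <= k <= m j)%N -> CkC 2 Px (phi j k))
  (phi_eigen : forall j, generalized_eigenfunctions f Px (lam j) (m j) (phi j))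
  (phi_conj : conjugation_stable Px lam m phi)
  (jx : 'I_n -> 'I_q) (kx : 'I_n -> nat)
  (jkx : enumerates m jx kx)
  (Phi_diffeo : diffeo_onto_image Px (Phi_vec lam jx kx phi)) :
  let Phi := Phi_vec lam jx kx phi in
  let Lambda := real_jordan lam jx kx in
  let Wbar := fun (x P : 'cV[R]_n) (t : R) =>
    (P^T *m expmx (- t *: Lambda) *m Phi x) 0 0 in
  (forall x, Px x -> Jac Phi x *m f x = Lambda *m Phi x) /\
  (forall (W0 : 'cV[R]_n -> R) (Pjk : 'I_q -> nat -> R),
     let P := \col_(a < n) Pjk (jx a) (kx a) in
     Ck 2 Px W0 ->
     (forall x, Px x ->
        W0 x = \sum_(j < q) \sum_(1 <= k < (m j).+1)
                 Pjk j k * real_form (lam j) (phi j k x)) ->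
     [/\ forall x, Px x -> W0 x = (P^T *m Phi x) 0 0,
         HJ_solution (H0 f) (Px `*` setT) (fun z => Wbar z.1 P z.2) /\
         (forall x, Px x -> Wbar x P 0 = W0 x),
         forall (D : set ('cV[R]_n * R)) (W : 'cV[R]_n * R -> R),
           open D -> D `<=` Px `*` setT ->
           HJ_solution (H0 f) D W ->
           (forall x, D (x, 0) -> W (x, 0) = W0 x) ->
           forall (c : R -> 'cV[R]_n) (t : R),
             (forall s, Num.min 0 t <= s <= Num.max 0 t ->
                D (c s, s) /\ is_derive s 1 c (f (c s))) ->
             W (c t, t) = Wbar (c t) P t
       & forall x t, Px x ->
           Wbar x P t =
             \sum_(j < q) Pjk j 1%N *
               real_form (lam j) (Cexp (- lam j * t%:C%C) * phi j 1%N x)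
           + \sum_(j < q) \sum_(2 <= k < (m j).+1) Pjk j k *
               real_form (lam j)
                 (Cexp (- lam j * t%:C%C) * phi j k x
                  + \sum_(1 <= i < k) ((- t) ^+ i / i`!%:R)%:C%C *
                      Cexp (- lam j * t%:C%C) * phi j (k - i)%N x)]) /\
  (exists T : R -> 'cV[R]_n * 'cV[R]_n -> 'cV[R]_n * 'cV[R]_n,
     [/\ forall t x p X P, Px x ->
           (generated_by Wbar t x p X P <-> T t (x, p) = (X, P)),
         forall t, canonical_coordinates (Px `*` setT) (T t),
         (forall t x p X P, Px x -> generated_by Wbar t x p X P ->
            H0 f x p + derive1 (fun s => Wbar x P s) t = 0) /\
         (forall x p, (grad (fun p' => H0 f x p') p)^T = f x /\
            (grad (fun x' => H0 f x' p) x)^T = (Jac f x)^T *m p),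
         completely_integrable_by (Px `*` setT) (H0 f) (fun t z => (T t z).2)
       & forall (I : set R) (x p : R -> 'cV[R]_n),
           open I -> (forall s, I s -> Px (x s)) ->
           (hamiltonian_solution (H0 f) I x p <->
            forall s, I s ->
              is_derive s 1 (fun t => (T t (x t, p t)).1) 0 /\
              is_derive s 1 (fun t => (T t (x t, p t)).2) 0)]).
Proof.
move=> Phi Lambda W.
have [lam_inj _ _ _] := spectrum.
have lam_conj := spectrum_conj spectrum.
have eig : forall x, Px x -> Jac Phi x *m f x = Lambda *m Phi x.
  exact: (Phi_vec_eigen lam_inj lam_conj jkx phi_C2 phi_eigen phi_conj).
have f_diff x : differentiable f x by exact: (f_smooth 1%N).1.
have C2 a : Ck 2 Px (fun x => Phi x a 0).
  exact: Phi_vec_C2 Px_open jkx phi_C2 a.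
split=> //; split.
  move=> W0 Pjk P cW0 W0E.
  have W0P x : Px x -> W0 x = (P^T *m Phi x) 0 0.
    move=> Pxx; rewrite W0E //; apply: esym.
    exact: (span_Phi_vec lam jkx (fun j k => phi j k x)).
  split=> //.
  - split; first exact: Wbar_HJ_solution Px_open Phi_diffeo eig P.
    by move=> x Pxx; rewrite W0P //; exact: (Wbar0 Phi Lambda).
  - move=> D V oD DP VS V0 c t.
    apply: (Wbar_unique Px_open Phi_diffeo eig oD DP VS) => x Dx0.
    by rewrite V0 // W0P //; have [] := DP _ Dx0.
  - move=> x t Pxx; apply: (Wbar_explicit lam_inj lam_conj jkx phi_conj _ Pjk t Pxx).
    exact: spectrum_mup_gt0 spectrum.
exists (action_map Phi Lambda); split.
- move=> t x p X P Pxx; exact: (generated_byP Lambda Px_open Phi_diffeo t p X P Pxx).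
- exact: (action_map_canonical Lambda Px_open C2 Phi_diffeo).
- split=> [t x p X P Pxx [-> _]|x p].
    exact: (Wbar_HJ Px_open Phi_diffeo eig P t Pxx).
  by rewrite grad_H0_p (grad_H0_x f_diff) trmxK trmx_mul trmxK.
- exact: (momenta_completely_integrable f_diff Px_open C2 Phi_diffeo eig).
- move=> I x p oI IP; split=> [/(hamiltonian_solutionE f_diff) H s Is|H].
    have [dx dp] := H s Is.
    exact: (hamiltonian_derive0 f_diff Px_open C2 Phi_diffeo eig (IP s Is) dx dp).
  apply/(hamiltonian_solutionE f_diff) => s Is; have [dX dP] := H s Is.
  exact: (derive0_hamiltonian f_diff Px_open C2 Phi_diffeo eig oI IP Is dX dP).
Qed.
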